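(* Let $L>0$, $\Omega=(0,L)$, $m\ge1$, $d_1,\dots,d_m>0$, and let $f_i:\Omega\times\mathbb{R}_+\times\mathbb{R}_+^m\to\mathbb{R}$, $i=1,\dots,m$, satisfy: (A1) each $f_i$ is locally Lipschitz continuous in its third argument $u$, uniformly with respect to $(x,t)$; and $f_i(x,t,u)\ge 0$ for all $(x,t)\in\Omega\times\mathbb{R}_+$ and all $u\in\mathbb{R}^m_+$ with $u_i=0$; (A2') $\sum_{i=1}^m f_i(x,t,u)=0$ for all $u\in\mathbb{R}^m_+$, $(x,t)\in\Omega\times\mathbb{R}_+$; (A3) there are $r\in[1,\infty)$, $C>0$ and a lower triangular matrix $A=(a_{ij})\in\mathbb{R}^{(m-1)\times(m-1)}$ with non-negative entries and positive diagonal entries such that for each $i=1,\dots,m-1$, $\sum_{j=1}^i a_{ij}f_j(x,t,u)\le C\left(1+\sum_{k=1}^m u_k\right)^r$ for all $u\in\mathbb{R}^m_+$, $(x,t)\in\Omega\times\mathbb{R}_+$. Let $u_{i,0}\in L^\infty(\Omega)$, $u_{i,0}\ge 0$, and let $u=(u_1,\dots,u_m)$ be the non-negative classical solution, on its maximal existence interval $[0,T_{\max})$, of $$\begin{cases}\partial_t u_i-d_i\partial_{xx}u_i=f_i(x,t,u), & x\in\Omega,\ t>0,\\ \partial_x u_i(0,t)=\partial_x u_i(L,t)=0, & t>0,\\ u_i(x,0)=u_{i,0}(x), & x\in\Omega,\end{cases}\qquad i=1,\dots,m.$$ Then there exist $\delta>0$ and $\mathscr{K}>0$ such that, for all $T\in(0,T_{\max})$,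 $$\sup_{i=1,\dots,m}\|u_i(T)\|_{\mathsf{M}^{1,\delta}(\Omega)}\le \mathscr{K}\big(d_i,\|u_{i,0}\|_{L^2(\Omega)}\big),$$ where $\mathscr{K}$ depends on the $d_i$ and $\|u_{i,0}\|_{L^2(\Omega)}$ and is independent of $T$.
   Context: $\mathbb{R}_+=[0,\infty)$. For $\delta>0$ the Morrey norm is $\|f\|_{\mathsf{M}^{1,\delta}(\Omega)}:=\sup_{0<\varepsilon<L}\ \sup_{x_0\in\Omega}\varepsilon^{-\delta}\|f\|_{L^1([x_0-\varepsilon,x_0+\varepsilon]\cap\Omega)}$. ''Locally Lipschitz in $u$ uniformly in $(x,t)$'' means that on each bounded set of $u\in\mathbb{R}^m_+$ there is a Lipschitz constant valid for all $(x,t)$. A classical solution on $(0,T)$, $T<\infty$, is $u$ with $u_i\in C([0,T);L^p(\Omega))\cap L^\infty((0,T)\times\Omega)\cap C^{1,2}((\tau,T)\times\overline\Omega)$ for all $i$, all $p>1$ and all $0<\tau<T$ ($C^1$ in time, $C^2$ in space), solving the system a.e. with the stated boundary and initial conditions. Under (A1) and for bounded non-negative initial data a non-negative classical solution exists on a maximal interval $[0,T_{\max})$ (it is a classical solution on $(0,T)$ for each finite $T<T_{\max}$), $0<T_{\max}\le\infty$. *)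

(* Defs.v *)
From HB Require Import structures.
From mathcomp Require Export all_boot all_order all_algebra.
From mathcomp Require Export all_classical all_reals all_analysis.
Export Order.TTheory GRing.Theory Num.Theory.
Export numFieldNormedType.Exports.

Set Implicit Arguments.
Unset Strict Implicit.
Unset Printing Implicit Defensive.

Open Scope classical_set_scope.
Open Scope ring_scope.

(* Functions of space are used through their values on the open interval
   `]0, L[ only; a function of time and space is written [u t x]. The
   nonlinearity keeps the order [f i x t u] and is total, but it is constrained
   only for x in `]0, L[, t >= 0 and u in the non-negative orthant. *)

Section NormsOnInterval.
Context {R : realType}.
Implicit Types (L : R) (p : \bar R) (g : R -> R).

(* Outside D the restriction [g \_ D] takes the value [point], which is 0 in
   R. *)
Definition Lp_norm (D : set R) p g : \bar R :=
  'N[lebesgue_measure]_p[EFin \o (g \_ D)]%E.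

Definition in_Lp (D : set R) p g : Prop :=
  (g \_ D : measurableTypeR R -> R) \in Lfun lebesgue_measure p.

Definition morrey_norm L (delta : R) g : \bar R :=
  ereal_sup [set y | exists e x0 : R,
    [/\ 0 < e < L, 0 < x0 < L
      & y = ((e `^ (- delta))%:E *
             Lp_norm (`[(x0 - e)%R, (x0 + e)%R] `&` `]0%R, L[) 1 g)%E]].

End NormsOnInterval.

Section FunctionSpaces.
Context {R : realType}.
Implicit Types (L T tau : R) (v : R -> R -> R).

Definition continuous_in_Lp L T (p : R) v : Prop :=
  (forall t : R, 0 <= t < T -> in_Lp `]0, L[ p%:E (v t)) /\
  (forall t : R, 0 <= t < T ->
     Lp_norm `]0, L[ p%:E (v s \- v t)
       @[s --> within `[0, T[ (nbhs t)] --> 0%E).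

Definition essentially_bounded L T v : Prop :=
  ((fun z : measurableTypeR R * measurableTypeR R => v z.1 z.2)
     \_ (`]0, T[ `*` `]0, L[))
  \in Lfun (lebesgue_measure \x lebesgue_measure)%E +oo%E.

Definition dt v (t x : R) : R := derive1 (fun s => v s x) t.
Definition dx v (t x : R) : R := derive1 (v t) x.
Definition dxx v (t x : R) : R := derive1 (derive1 (v t)) x.

Definition continuous_up_to_boundary L tau T v : Prop :=
  exists G : R * R -> R,
    {within `]tau, T[ `*` `[0, L], continuous G} /\
    forall t x : R, tau < t < T -> 0 < x < L -> G (t, x) = v t x.

(* C^{1,2}((tau, T) x [0, L]): the derivatives exist in the interior and
   extend continuously up to x = 0 and x = L. *)
Record C12 L tau T v : Prop := {
  C12_cont : {within `]tau, T[ `*` `[0, L],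
    continuous (fun z : R * R => v z.1 z.2)} ;
  C12_dt : forall t x : R, tau < t < T -> 0 < x < L ->
    derivable (fun s => v s x) t 1 ;
  C12_dx : forall t x : R, tau < t < T -> 0 < x < L -> derivable (v t) x 1 ;
  C12_dxx : forall t x : R, tau < t < T -> 0 < x < L ->
    derivable (derive1 (v t)) x 1 ;
  C12_dt_cont : continuous_up_to_boundary L tau T (dt v) ;
  C12_dx_cont : continuous_up_to_boundary L tau T (dx v) ;
  C12_dxx_cont : continuous_up_to_boundary L tau T (dxx v) }.

End FunctionSpaces.

Section ReactionDiffusion.
Context {R : realType} {m : nat}.
Implicit Types (L T : R) (d : 'I_m -> R).
Implicit Types (f : 'I_m -> R -> R -> 'rV[R]_m -> R).
Implicit Types (u : 'I_m -> R -> R -> R) (init : 'I_m -> R -> R).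

Definition orthant : set 'rV[R]_m := [set w | forall i, 0 <= w ord0 i].

Definition locally_lipschitz_uniformly L f : Prop :=
  forall i (B : set 'rV[R]_m), bounded_set B -> B `<=` orthant ->
  exists k : R, forall x t : R, 0 < x < L -> 0 <= t -> k.-lipschitz_B (f i x t).

Definition quasi_positive L f : Prop :=
  forall i (x t : R) w, 0 < x < L -> 0 <= t -> orthant w -> w ord0 i = 0 ->
  0 <= f i x t w.

Definition mass_conserving L f : Prop :=
  forall (x t : R) w, 0 < x < L -> 0 <= t -> orthant w -> \sum_i f i x t w = 0.

(* Row i of A acts on f_1, ..., f_i, where 'I_m.-1 is embedded in 'I_m by
   forgetting the last index; [is_trig_mx] means lower triangular. *)
Definition intermediate_sums L f : Prop :=
  exists (r C : R) (A : 'M[R]_(m.-1)),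
  [/\ 1 <= r, 0 < C,
      [/\ is_trig_mx A, forall i j, 0 <= A i j & forall i, 0 < A i i]
    & forall (i : 'I_m.-1) (x t : R) w, 0 < x < L -> 0 <= t -> orthant w ->
      \sum_(j < m.-1 | (j <= i)%N) A i j * f (widen_ord (leq_pred m) j) x t w
      <= C * (1 + \sum_k w ord0 k) `^ r].

Definition initial_datum L init : Prop :=
  forall i, in_Lp `]0, L[ +oo%E (init i) /\
    {ae lebesgue_measure, forall x : R, 0 < x < L -> 0 <= init i x}.

(* The boundary values of the space derivative are those of its continuous
   extension, that is, one-sided limits. *)
Record classical_solution L d f init T u : Prop := {
  cs_Lp : forall i (p : R), 1 < p -> continuous_in_Lp L T p (u i) ;
  cs_bounded : forall i, essentially_bounded L T (u i) ;
  cs_C12 : forall i (tau : R), 0 < tau < T -> C12 L tau T (u i) ;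
  cs_equation : forall i,
    {ae (lebesgue_measure \x lebesgue_measure)%E, forall z : R * R,
      0 < z.1 < T -> 0 < z.2 < L ->
      dt (u i) z.1 z.2 - d i * dxx (u i) z.1 z.2
      = f i z.2 z.1 (\row_j u j z.1 z.2)} ;
  cs_boundary : forall i (t : R), 0 < t < T ->
    dx (u i) t x @[x --> 0^'+] --> 0 /\ dx (u i) t x @[x --> L^'-] --> 0 ;
  cs_initial : forall i,
    {ae lebesgue_measure, forall x : R, 0 < x < L -> u i 0 x = init i x} }.

Definition nonnegative L T u : Prop :=
  forall i (t x : R), 0 < t < T -> 0 < x < L -> 0 <= u i t x.

Definition maximal_solution L d f init (Tmax : \bar R) u : Prop :=
  [/\ (0 < Tmax)%E,
      forall T : R, 0 < T -> (T%:E < Tmax)%E ->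
        classical_solution L d f init T u /\ nonnegative L T u
    & forall (T : R) v, (Tmax < T%:E)%E ->
        classical_solution L d f init T v -> nonnegative L T v ->
        ~ (forall i (t x : R), 0 < t -> (t%:E < Tmax)%E -> 0 < x < L ->
             v i t x = u i t x)].

End ReactionDiffusion.

(* Main.v *)
Require Import Defs.
From mathcomp Require Import measurable_realfun ring lra.

Set Implicit Arguments.
Unset Strict Implicit.
Unset Printing Implicit Defensive.

(* Write z for the total mass density \sum_i u_i. Mass conservation makes z a
   Fokker-Planck density, z_t = (a z)_xx with a between min d_i and max d_i, and
   Neumann conditions. If a test function phi satisfies phi_t + d_i phi_xx <= 0
   for every i, and if its outward normal derivative is non-negative, then the
   integral of z * phi over `]0, L[ does not increase in time. With
   Lam >= max d_i and lam <= min d_i, the function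
     psi(s, y) = s^(-q) exp(- y^2 / (4 Lam s)),   q <= lam / (2 Lam),
   satisfies psi_s >= e psi_yy for all e in [lam, Lam]. Take
   phi = psi(T + eps^2 - t, x - x0), corrected by two mirror images and a
   quadratic polynomial to get the boundary sign: at time T it is at least
   c eps^(-2q) on the ball of radius eps around x0, so the mass of that ball is
   O(eps^(2q)) times the integral of z * phi at an earlier time. If T <= 1 that
   earlier time is close to 0, where z and phi are both bounded in L^2, since
   q <= 1/4; if T > 1 it is T - 1, where phi is bounded and z is bounded in
   L^1. *)

(** * Almost everywhere identities between continuous functions *)

Section ae.
Context {R : realType}.
Notation mu := (@lebesgue_measure R).

(** If [E] were non-zero at a point of the box, continuity would make it non-zero on a product of
    two balls inside the box. That product would lie in the exceptional null set, yet it has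
    positive measure. *)
Lemma ae_box_eq0 (E : R * R -> R) (a b c d : R) :
  {ae (mu \x mu)%E, forall z : R * R,
    a < z.1 < b -> c < z.2 < d -> E z = 0} ->
  {in `]a, b[ `*` `]c, d[, continuous E} ->
  forall t x, a < t < b -> c < x < d -> E (t, x) = 0.
Proof.
move=> [N [mN N0 subN]] cE t x tab xcd; apply/eqP/negPn/negP => Etx.
have : \forall z \near (t, x), [/\ E z != 0, a < z.1 < b & c < z.2 < d].
  have zin : (t, x) \in `]a, b[ `*` `]c, d[.
    by rewrite inE; split; rewrite /= in_itv.
  have h1 : \forall z \near (t, x), E z != 0.
    have : \forall y \near E (t, x), y != 0.
      by apply: open_nbhs_nbhs; split => //; exact: open_neq.
    exact: (cE _ zin).
  have h2 : \forall z \near (t, x), a < z.1 < b.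
    have : \forall s \near t, a < s < b by apply: near_in_itvoo; rewrite in_itv.
    exact: cvg_fst.
  have h3 : \forall z \near (t, x), c < z.2 < d.
    have : \forall s \near x, c < s < d by apply: near_in_itvoo; rewrite in_itv.
    exact: cvg_snd.
  by near=> z; split; near: z.
move=> [[/= U V] [/nbhs_ballP[r /= r0 rU] /nbhs_ballP[r' /= r'0 rV]] UV].
have boxN : ball t r `*` ball x r' `<=` N.
  move=> [s y] /= [/rU Us /rV Vy]; apply: subN => /=.
  have [/eqP Eq st yt] := UV (s, y) (conj Us Vy).
  by move=> /(_ st yt).
have mB y e : measurable (ball y e : set (measurableTypeR R)).
  exact: measurable_ball.
have : ((mu \x mu)%E (ball t r `*` ball x r') <= 0)%E.
  rewrite -N0; apply: le_measure; rewrite ?inE//.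
  exact: measurableX (mB _ _) (mB _ _).
rewrite product_measure1E//.
rewrite [X in (X * _)%E](lebesgue_measure_ball t (ltW r0)).
rewrite [X in (_ * X)%E](lebesgue_measure_ball x (ltW r'0)).
by rewrite -EFinM lee_fin leNgt mulr_gt0// mulrn_wgt0.
Unshelve. all: end_near. Qed.
End ae.

(** * Functions continuous up to the lateral boundary of a space-time slab *)

Section up_to_boundary.
Context {R : realType}.
Context (L tau T : R).
Implicit Types v w : R -> R -> R.
Notation mu := (@lebesgue_measure R).
Notation slab := (`]tau, T[ `*` `[0, L]).
Notation cub := (continuous_up_to_boundary L tau T).

Lemma up_to_boundary_ext v w :
  (forall t x, tau < t < T -> 0 < x < L -> v t x = w t x) -> cub v -> cub w.
Proof.
by move=> vw [G [cG GE]]; exists G; split=> // t x tT xL; rewrite GE// vw.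
Qed.

Lemma within_up_to_boundary v :
  {within slab, continuous (fun z => v z.1 z.2)} -> cub v.
Proof. by move=> cv; exists (fun z => v z.1 z.2). Qed.

Lemma up_to_boundaryD v w :
  cub v -> cub w -> cub (fun t x => v t x + w t x).
Proof.
move=> [G [cG GE]] [H [cH HE]]; exists (G \+ H); split=> [z|t x tT xL /=].
  by apply: cvgD; [exact: cG|exact: cH].
by rewrite GE// HE.
Qed.

Lemma up_to_boundaryM v w :
  cub v -> cub w -> cub (fun t x => v t x * w t x).
Proof.
move=> [G [cG GE]] [H [cH HE]]; exists (G \* H); split=> [z|t x tT xL /=].
  by apply: cvgM; [exact: cG|exact: cH].
by rewrite GE// HE.
Qed.

Lemma up_to_boundary_cst (k : R) : cub (fun _ _ => k).
Proof. by exists (cst k); split=> // z; exact: cvg_cst. Qed.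

Lemma up_to_boundary_sum n (v : 'I_n -> R -> R -> R) :
  (forall i, cub (v i)) -> cub (fun t x => \sum_i v i t x).
Proof.
move=> /choice[G HG]; exists (fun z => \sum_i G i z); split=> [z|t x tT xL].
  by apply: cvg_big => [|i _]; [exact: add_continuous|exact: (HG i).1].
by apply: eq_bigr => i _; rewrite (HG i).2.
Qed.

Lemma up_to_boundary_bounded v a b : tau < a -> b < T -> cub v ->
  exists M : R, 0 <= M /\
    forall t x, a <= t <= b -> 0 < x < L -> `|v t x| <= M.
Proof.
move=> ta bT [G [cG GE]].
have sub : `[a, b] `*` `[0, L] `<=` slab.
  move=> [t x] [/= + xL]; rewrite in_itv/= => /andP[at_ tb]; split => //=.
  by rewrite in_itv/= (lt_le_trans ta)// (le_lt_trans tb).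
have cK : compact (`[a, b] `*` `[0, L] : set (R * R)).
  by apply: compact_setX; exact: segment_compact.
have /compact_bounded[M [_ HM]] :=
  continuous_compact (continuous_subspaceW sub cG) cK.
exists (`|M| + 1); split=> [|t x /andP[at_ tb] /andP[x0 xL]].
  by rewrite addr_ge0.
have tT : tau < t < T by rewrite (lt_le_trans ta)// (le_lt_trans tb).
rewrite -GE ?x0//; apply: (HM (`|M| + 1)).
  by rewrite (le_lt_trans (ler_norm _))// ltrDl.
by exists (t, x) => //; split; rewrite /= in_itv/= ?at_ ?tb ?ltW.
Qed.

Lemma slice_within t (G : R * R -> R) : tau < t < T ->
  {within slab, continuous G} ->
  {within `[0, L], continuous (fun x => G (t, x))}.
Proof.
move=> tT /subspace_continuousP cG; apply/subspace_continuousP => x xL.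
have tx : slab (t, x) by split => //=; rewrite in_itv.
apply: cvg_comp (cG _ tx) => U /= nU.
have ctx : (t, y) @[y --> x] --> (t, x).
  exact: cvg_pair (cvg_cst t) cvg_id.
have ctU : nbhs x (fun y => slab (t, y) -> U (t, y)) := ctx _ nU.
apply: filterS ctU => y yU yL; apply: yU.
by split => //=; rewrite in_itv.
Qed.

Lemma up_to_boundary_slice v t : tau < t < T -> cub v ->
  exists g : R -> R, {within `[0, L], continuous g} /\
    forall x, 0 < x < L -> g x = v t x.
Proof.
move=> tT [G [cG GE]]; exists (fun x => G (t, x)); split=> [|x xL].
  exact: slice_within.
exact: GE.
Qed.

Lemma integrable_up_to_boundary v t : tau < t < T -> cub v ->
  mu.-integrable `]0, L[ (EFin \o v t).
Proof.
move=> tT /(up_to_boundary_slice tT)[g [cg gE]].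
have gv : {in `]0, L[%classic, EFin \o g =1 EFin \o v t}.
  by move=> x; rewrite inE/= in_itv/= => xL; rewrite /= gE.
refine (@eq_integrable _ _ R mu _ _ (EFin \o g) _ gv _) => //.
have sub : `]0, L[ `<=` `[0, L]%classic by exact: subset_itv_oo_cc.
apply: (@integrableS _ _ R mu _ _ _ _ _ sub) => //.
by apply: continuous_compact_integrable => //; exact: segment_compact.
Qed.

(** On an open subset of the slab, continuity within the slab is ordinary continuity, and [v]
    coincides with its extension near each interior point. *)
Lemma up_to_boundary_continuous v : cub v ->
  {in `]tau, T[ `*` `]0, L[, continuous (fun z => v z.1 z.2)}.
Proof.
move=> [G [cG GE]].
have oI : open (`]tau, T[ `*` `]0, L[ : set (R * R)).
  rewrite openE => -[t x] [/= tI xI].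
  by exists (`]tau, T[%classic, `]0, L[%classic) => //=; split;
    apply: open_nbhs_nbhs; split => //; exact: interval_open.
have sub : `]tau, T[ `*` `]0, L[ `<=` slab.
  by move=> z [z1 z2]; split => //; exact: subset_itv_oo_cc.
have := continuous_subspaceW sub cG; rewrite continuous_open_subspace// => cI.
have GEv z : (`]tau, T[ `*` `]0, L[) z -> G z = v z.1 z.2.
  by case: z => t x [/=]; rewrite !in_itv/=; exact: GE.
move=> z zI; rewrite /continuous_at -GEv; last by rewrite inE in zI.
apply: cvg_trans (cI z zI); apply: near_eq_cvg.
rewrite inE in zI; have zn := open_nbhs_nbhs (conj oI zI).
by apply: filterS zn => y; exact: GEv.
Qed.

(** Dominated differentiation under the integral: on a compact time interval around [t], bounded by
    midpoints, [w] is dominated by a constant, which is integrable on []0, L[]. *)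
Lemma is_derive_Rintegral v w t : tau < t < T -> cub v -> cub w ->
  (forall s x : R, tau < s < T -> 0 < x < L ->
     is_derive s 1 (v ^~ x) (w s x)) ->
  is_derive t 1 (fun s => \int[mu]_(x in `]0, L[) v s x)
    (\int[mu]_(x in `]0, L[) w t x).
Proof.
move=> /andP[ta tT] cv cw dv.
pose a := (tau + t) / 2; pose b := (t + T) / 2.
have [tau_a at_] := (midf_lt ta).
have [tb bT] := (midf_lt tT).
have abT s : a < s < b -> tau < s < T.
  by move=> /andP[as_ sb]; rewrite (lt_trans _ as_)//= (lt_trans sb).
have [M [M0 wM]] := up_to_boundary_bounded tau_a bT cw.
have Ia : `]a, b[%classic t by rewrite /= in_itv/= at_.
have intv s : `]a, b[%classic s -> mu.-integrable `]0, L[ (EFin \o v s).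
  by rewrite /= in_itv/= => /abT sT; exact: integrable_up_to_boundary cv.
have derv s x : `]a, b[%classic s -> `]0, L[%classic x ->
    derivable (v ^~ x) s 1.
  by rewrite /= !in_itv/= => /abT sT xL; have [] := dv s x sT xL.
have dvE s x : a < s < b -> 0 < x < L -> partial1of2 v s x = w s x.
  by move=> /abT sT xL; rewrite partial1of2E; have [_] := dv s x sT xL.
have intM : mu.-integrable `]0, L[ (EFin \o cst M).
  apply: (@integrable_up_to_boundary (fun _ _ => M) t); first by rewrite ta.
  exact: up_to_boundary_cst.
have vM s x : `]a, b[%classic s -> `]0, L[%classic x ->
    `|partial1of2 v s x| <= cst M x.
  rewrite /= !in_itv/= => sab xL; rewrite dvE//.
  by case/andP: sab => as_ sb; rewrite wM// !ltW.
apply: DeriveDef.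
  exact: (derivable_under_integral _ Ia intv derv (fun=> M0) intM vM).
rewrite -derive1E.
rewrite (differentiation_under_integral _ Ia intv derv (fun=> M0) intM vM)//.
apply: eq_Rintegral => x; rewrite inE/= in_itv/= => xL.
by rewrite dvE// at_.
Qed.

End up_to_boundary.

(** * Fundamental theorem of calculus with extended boundary values *)

Section ftc.
Context {R : realType}.
Context (L : R).
Notation mu := (@lebesgue_measure R).

(** The primitive [h] is controlled only inside the interval, and its continuous extension [G]
    carries the boundary values. The distinction matters for [dx u], whose raw values at 0 and [L]
    would involve points outside the domain. *)
Lemma Rintegral_oo_FTC2 (h g G : R -> R) : 0 < L ->
  {within `[0, L], continuous g} -> {within `[0, L], continuous G} ->
  (forall x, 0 < x < L -> is_derive x 1 h (g x) /\ G x = h x) ->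
  \int[mu]_(x in `]0, L[) g x = G L - G 0.
Proof.
move=> L0 cg cG hE.
have dG x : x \in `]0, L[ -> is_derive x 1 G (g x).
  move=> xL; have : {near x, h =1 G}.
    near=> y; rewrite (hE y _).2//.
    by have : y \in `]0, L[ by near: y; apply: near_in_itvoo.
  have xL' : 0 < x < L by [].
  by move=> /near_eq_is_derive; apply; exact: (hE _ xL').1.
rewrite Rintegral_itv_obnd_cbnd; last first.
  have sub : `]0, L[ `<=` `[0, L]%classic by exact: subset_itv_oo_cc.
  apply: (@integrableS _ _ R mu _ _ _ _ _ sub) => //.
  by apply: continuous_compact_integrable => //; exact: segment_compact.
rewrite Rintegral_itv_bndo_bndc; last first.
  have sub : `[0, L[ `<=` `[0, L]%classic by exact: subset_itv_co_cc.
  apply: (@integrableS _ _ R mu _ _ _ _ _ sub) => //.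
  by apply: continuous_compact_integrable => //; exact: segment_compact.
rewrite /Rintegral (@continuous_FTC2 _ g G)//.
- have [_ G0 GL] := (continuous_within_itvP _ L0).1 cG.
  by split=> // x /dG[].
- by move=> x /dG xg; rewrite derive1E derive_val.
Unshelve. all: end_near. Qed.
End ftc.

(** Derivatives are carried explicitly and demanded for every real [x], so the slopes of a test
    function at 0 and [L] are ordinary derivatives, unlike those of the solution. *)
Record test_function {R : realType} (S : R)
    (phi phit phix phixx : R -> R -> R) : Prop := {
  test_t : forall t x : R, t < S -> is_derive t 1 (phi ^~ x) (phit t x) ;
  test_x : forall t x : R, t < S -> is_derive x 1 (phi t) (phix t x) ;
  test_xx : forall t x : R, t < S -> is_derive x 1 (phix t) (phixx t x) ;
  test_cont : forall z : R * R, z.1 < S ->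
    {for z, continuous (fun z : R * R => phi z.1 z.2)} ;
  test_contt : forall z : R * R, z.1 < S ->
    {for z, continuous (fun z : R * R => phit z.1 z.2)} ;
  test_contx : forall z : R * R, z.1 < S ->
    {for z, continuous (fun z : R * R => phix z.1 z.2)} ;
  test_contxx : forall z : R * R, z.1 < S ->
    {for z, continuous (fun z : R * R => phixx z.1 z.2)} }.

(** * Duality between a solution and a test function *)

Section solution.
Context {R : realType} {m : nat} {L S : R} {d : 'I_m -> R}.
Context {f : 'I_m -> R -> R -> 'rV[R]_m -> R} {init : 'I_m -> R -> R}.
Context {u : 'I_m -> R -> R -> R}.
Context (L_gt0 : 0 < L) (d_gt0 : forall i, 0 < d i).
Context (f0 : mass_conserving L f).
Context (u_sol : classical_solution L d f init S u).
Context (u_ge0 : nonnegative L S u).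
Notation mu := (@lebesgue_measure R).

Let slabW tau (v : R * R -> R) :
  (forall z : R * R, z.1 < S -> {for z, continuous v}) ->
  {within `]tau, S[ `*` `[0, L], continuous v}.
Proof.
move=> cv; apply: continuous_in_subspaceT => z; rewrite inE => -[/=].
by rewrite in_itv/= => /andP[_ zS] _; exact: cv.
Qed.

(** The solution is regular on []tau, S[] only for positive [tau]; [t / 2] is the [tau] used to
    reach time [t]. *)
Let half t : 0 < t < S -> 0 < t / 2 < S /\ t / 2 < t < S.
Proof.
move=> /andP[t0 tS]; have tt : t / 2 < t.
  by rewrite ltr_pdivrMr// ltr_pMr// ltr1n.
by rewrite divr_gt0// tt (lt_trans tt).
Qed.

(** Summing the equations cancels the reactions almost everywhere; what remains is continuous in the
    interior, so it vanishes at every point. *)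
Lemma reaction_free_balance t x : 0 < t < S -> 0 < x < L ->
  \sum_i (dt (u i) t x - d i * dxx (u i) t x) = 0.
Proof.
pose E (z : R * R) := \sum_i (dt (u i) z.1 z.2 - d i * dxx (u i) z.1 z.2).
move=> tS xL; apply: (@ae_box_eq0 _ E 0 S 0 L) => //.
  have : {ae (mu \x mu)%E, forall z : R * R, forall i,
      0 < z.1 < S -> 0 < z.2 < L ->
      dt (u i) z.1 z.2 - d i * dxx (u i) z.1 z.2
      = f i z.2 z.1 (\row_j u j z.1 z.2)}.
    apply: (@filter_forall _ _ _ _ (ae_filter_ringOfSetsType _)) => i.
    exact: cs_equation u_sol i.
  apply: (@filterS _ _ (ae_filter_ringOfSetsType _)) => -[s y] /= eqn sS yL.
  rewrite /E/=.
  under eq_bigr do rewrite eqn//.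
  apply: f0 => //; first by case/andP: sS => /ltW.
  by move=> i; rewrite mxE u_ge0.
move=> -[s y]; rewrite inE => -[/=]; rewrite !in_itv/= => sS yL.
have [s2S s2s] := half sS.
apply: (@up_to_boundary_continuous _ L (s / 2) S
  (fun s y => \sum_i (dt (u i) s y - d i * dxx (u i) s y))); last first.
  by rewrite inE; split; rewrite /= in_itv.
apply: up_to_boundary_sum => i; have [_ _ _ _ ct _ cxx] := cs_C12 u_sol i s2S.
have := up_to_boundaryD ct
  (up_to_boundaryM (up_to_boundary_cst _ _ _ (- d i)) cxx).
by apply: up_to_boundary_ext => r z _ _; rewrite mulNr.
Qed.

(** The Neumann condition is a pair of one-sided limits; uniqueness of limits turns it into the
    endpoint values of the continuous extension. *)
Lemma sol_x_extension i t : 0 < t < S ->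
  exists G : R -> R, [/\ {within `[0, L], continuous G},
    forall x, 0 < x < L -> G x = dx (u i) t x, G 0 = 0 & G L = 0].
Proof.
move=> tS; have [t2S t2t] := half tS.
have [_ _ _ _ _ cx _] := cs_C12 u_sol i t2S.
have [G [cG GE]] := up_to_boundary_slice t2t cx.
have [_ G0 GL] := (continuous_within_itvP _ L_gt0).1 cG.
have [dx0 dxL] := cs_boundary u_sol i tS.
exists G; split=> //.
- rewrite -(cvg_lim (@Rhausdorff R) G0); apply: cvg_lim => //.
  apply: cvg_trans dx0; apply: near_eq_cvg.
  near=> x; rewrite GE//; apply/andP; split; near: x.
    exact: nbhs_right_gt.
  exact: nbhs_right_lt.
- rewrite -(cvg_lim (@Rhausdorff R) GL); apply: cvg_lim => //.
  apply: cvg_trans dxL; apply: near_eq_cvg.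
  near=> x; rewrite GE//; apply/andP; split; near: x.
    exact: nbhs_left_gt.
  exact: nbhs_left_lt.
Unshelve. all: end_near. Qed.

Lemma sol_slice_continuous i t : 0 < t < S ->
  {within `[0, L], continuous (u i t)}.
Proof.
move=> /half[t2S t2t].
have [cu _ _ _ _ _ _] := cs_C12 u_sol i t2S.
exact: (slice_within t2t cu).
Qed.

(** Endpoint values are limits of non-negative interior values. They occur in the boundary terms of
    Green's formula. *)
Lemma sol_ge0_closed i t x : 0 < t < S -> 0 <= x <= L -> 0 <= u i t x.
Proof.
move=> tS /andP[x0 xL].
have [_ u0 uL] :=
  (continuous_within_itvP _ L_gt0).1 (@sol_slice_continuous i t tS).
have [->|xn0] := eqVneq x 0.
  rewrite -(cvg_lim (@Rhausdorff R) u0); apply: limr_ge.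
    by apply/cvg_ex; exists (u i t 0).
  near=> y; apply: u_ge0 => //; apply/andP; split; near: y.
    exact: nbhs_right_gt.
  exact: nbhs_right_lt.
have [->|xnL] := eqVneq x L.
  rewrite -(cvg_lim (@Rhausdorff R) uL); apply: limr_ge.
    by apply/cvg_ex; exists (u i t L).
  near=> y; apply: u_ge0 => //; apply/andP; split; near: y.
    exact: nbhs_left_gt.
  exact: nbhs_left_lt.
by apply: u_ge0; rewrite // lt_neqAle eq_sym xn0 x0 lt_neqAle xnL.
Unshelve. all: end_near. Qed.

Context {phi phit phix phixx : R -> R -> R}.
Context (phi_test : test_function S phi phit phix phixx).
Context (phi_super : forall i (t x : R), 0 < t < S -> 0 < x < L ->
  phit t x + d i * phixx t x <= 0).
Context (phix0 : forall t, 0 < t < S -> phix t 0 <= 0).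
Context (phixL : forall t, 0 < t < S -> 0 <= phix t L).

Let pairing t x := \sum_i u i t x * phi t x.
Let dpairing t x := \sum_i (dt (u i) t x * phi t x + u i t x * phit t x).

Let test_up_to_boundary tau (v : R -> R -> R) :
  (forall z : R * R, z.1 < S -> {for z, continuous (fun z => v z.1 z.2)}) ->
  continuous_up_to_boundary L tau S v.
Proof. by move=> cv; apply: within_up_to_boundary; exact: slabW. Qed.

Let pairing_up_to_boundary t : 0 < t < S ->
  continuous_up_to_boundary L (t / 2) S pairing.
Proof.
move=> /half[t2S _]; apply: up_to_boundary_sum => i.
have [cu _ _ _ _ _ _] := cs_C12 u_sol i t2S.
apply: up_to_boundaryM; first exact: within_up_to_boundary.
exact: test_up_to_boundary (test_cont phi_test).
Qed.

Let dpairing_up_to_boundary t : 0 < t < S ->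
  continuous_up_to_boundary L (t / 2) S dpairing.
Proof.
move=> /half[t2S _]; apply: up_to_boundary_sum => i.
have [cu _ _ _ cut _ _] := cs_C12 u_sol i t2S.
apply: up_to_boundaryD; apply: up_to_boundaryM.
- exact: cut.
- exact: test_up_to_boundary (test_cont phi_test).
- exact: within_up_to_boundary.
- exact: test_up_to_boundary (test_contt phi_test).
Qed.

Let is_derive_pairing t x : 0 < t < S -> 0 < x < L ->
  is_derive t 1 (pairing ^~ x) (dpairing t x).
Proof.
move=> tS xL; have [t2S t2t] := half tS.
have -> : pairing ^~ x = \sum_i (fun s => u i s x * phi s x).
  by apply/funext => s; rewrite fct_sumE.
apply: is_derive_sum => i.
have [_ du _ _ _ _ _] := cs_C12 u_sol i t2S.
have du' : is_derive t 1 (u i ^~ x) (dt (u i) t x).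
  by apply: DeriveDef; [exact: du|rewrite /dt derive1E].
have t_lt : t < S by case/andP: tS.
have dphi := test_t phi_test x t_lt.
apply: (is_derive_eq (is_deriveM du' dphi)).
by rewrite /GRing.scale/=; ring.
Qed.

(** Green's formula: the balance and the differential inequality for [phi] bound the integrand by an
    exact space derivative, whose boundary terms have the right sign. *)
Let Rintegral_dpairing_le0 t : 0 < t < S ->
  \int[mu]_(x in `]0, L[) dpairing t x <= 0.
Proof.
move=> tS; have [t2S t2t] := half tS; have /andP[_ t_lt] := tS.
(* This is the space derivative of the flux [h] below, the sum of [d_i (u_x phi - u phi_x)]. *)
pose g s x := \sum_i (d i * (dxx (u i) s x * phi s x)
                     + (- d i) * (u i s x * phixx s x)).
have cg : continuous_up_to_boundary L (t / 2) S g.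
  apply: up_to_boundary_sum => i.
  have [cu _ _ _ _ _ cuxx] := cs_C12 u_sol i t2S.
  apply: up_to_boundaryD; (apply: up_to_boundaryM;
    [exact: up_to_boundary_cst|apply: up_to_boundaryM]).
  - exact: cuxx.
  - exact: test_up_to_boundary (test_cont phi_test).
  - exact: within_up_to_boundary.
  - exact: test_up_to_boundary (test_contxx phi_test).
have [ge [cge geE]] := up_to_boundary_slice t2t cg.
have /choice[Gx GxP] : forall i, exists G : R -> R,
    [/\ {within `[0, L], continuous G},
    forall x, 0 < x < L -> G x = dx (u i) t x, G 0 = 0 & G L = 0].
  by move=> i; exact: sol_x_extension.
pose h x := \sum_i (d i * (dx (u i) t x * phi t x)
                    + (- d i) * (u i t x * phix t x)).
pose G x := \sum_i (d i * (Gx i x * phi t x)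
                    + (- d i) * (u i t x * phix t x)).
have cphi x : {for x, continuous (phi t)}.
  by apply/differentiable_continuous/derivable1_diffP;
    have [] := test_x phi_test x t_lt.
have cphix x : {for x, continuous (phix t)}.
  by apply/differentiable_continuous/derivable1_diffP;
    have [] := test_xx phi_test x t_lt.
have cG : {within `[0, L], continuous G}.
  move=> x; apply: cvg_big => [|i _]; first exact: add_continuous.
  have [cGx _ _ _] := GxP i.
  apply: cvgD; (apply: cvgM; [exact: cvg_cst|apply: cvgM]).
  - exact: cGx.
  - by apply: continuous_subspaceT => y; exact: cphi.
  - exact: sol_slice_continuous.
  - by apply: continuous_subspaceT => y; exact: cphix.
have dh x : 0 < x < L -> is_derive x 1 h (ge x) /\ G x = h x.
  move=> xL; split; last first.
    by apply: eq_bigr => i _; have [_ GE _ _] := GxP i; rewrite GE.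
  rewrite geE//.
  have -> : h = \sum_i (fun x => d i * (dx (u i) t x * phi t x)
                    + (- d i) * (u i t x * phix t x)).
    by apply/funext => s; rewrite fct_sumE.
  apply: is_derive_sum => i.
  have [_ _ dux duxx _ _ _] := cs_C12 u_sol i t2S.
  have d1 : is_derive x 1 (u i t) (dx (u i) t x).
    by apply: DeriveDef; [exact: dux|rewrite /dx derive1E].
  have d2 : is_derive x 1 (dx (u i) t) (dxx (u i) t x).
    by apply: DeriveDef; [exact: duxx|rewrite /dxx derive1E].
  have d3 := test_x phi_test x t_lt.
  have d4 := test_xx phi_test x t_lt.
  apply: (is_derive_eq (is_deriveD (is_deriveZ (d i) (is_deriveM d2 d3))
    (is_deriveZ (- d i) (is_deriveM d1 d4)))).
  by rewrite /GRing.scale/=; ring.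
have le_g :
    \int[mu]_(x in `]0, L[) dpairing t x <= \int[mu]_(x in `]0, L[) ge x.
  have -> : \int[mu]_(x in `]0, L[) ge x = \int[mu]_(x in `]0, L[) g t x.
    by apply: eq_Rintegral => x; rewrite inE/= in_itv/=; exact: geE.
  apply: le_Rintegral => //.
  - exact: integrable_up_to_boundary (dpairing_up_to_boundary tS).
  - exact: integrable_up_to_boundary cg.
  move=> x; rewrite /= in_itv/= => xL.
  rewrite -subr_le0 -sumrB.
  have bal := reaction_free_balance tS xL.
  (* Since [phi] is common to all components, the difference splits into the balance times [phi],
     which vanishes, and a sum of products [u_i (phi_t + d_i phi_xx)], each non-positive. *)
  have -> : \sum_i (dt (u i) t x * phi t x + u i t x * phit t x -
      (d i * (dxx (u i) t x * phi t x) + - d i * (u i t x * phixx t x))) =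
    (\sum_i (dt (u i) t x - d i * dxx (u i) t x)) * phi t x +
    \sum_i u i t x * (phit t x + d i * phixx t x).
    rewrite mulr_suml -big_split/=; apply: eq_bigr => i _; ring.
  rewrite bal mul0r add0r; apply: sumr_le0 => i _.
  by rewrite mulr_ge0_le0// ?u_ge0// phi_super.
(* Only [- d_i u phi_x] survives at the endpoints; it is non-positive at [L] and non-negative at
   0. *)
apply: (le_trans le_g); rewrite (Rintegral_oo_FTC2 L_gt0 cge cG dh).
rewrite subr_le0 (@le_trans _ _ 0)//.
  apply: sumr_le0 => i _; have [_ _ _ ->] := GxP i.
  rewrite mul0r mulr0 add0r mulNr oppr_le0.
  apply: mulr_ge0; [exact: ltW|apply: mulr_ge0; last exact: phixL].
  by apply: sol_ge0_closed; rewrite // lexx ltW.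
apply: sumr_ge0 => i _; have [_ _ -> _] := GxP i.
rewrite mul0r mulr0 add0r mulNr -mulrN.
apply: mulr_ge0; [exact: ltW|rewrite -mulrN; apply: mulr_ge0].
  by apply: sol_ge0_closed; rewrite // lexx ltW.
by rewrite oppr_ge0 phix0.
Qed.

(** The time derivative of the pairing is the integral just shown to be non-positive. The time [t1]
    is positive because the regularity of the solution does not reach time 0. *)
Lemma pairing_nonincreasing t1 t2 : 0 < t1 -> t1 <= t2 -> t2 < S ->
  \int[mu]_(x in `]0, L[) (\sum_i u i t2 x * phi t2 x) <=
  \int[mu]_(x in `]0, L[) (\sum_i u i t1 x * phi t1 x).
Proof.
move=> t1_gt0 t12 t2S.
pose I t := \int[mu]_(x in `]0, L[) pairing t x.
have dI t : 0 < t < S ->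
    is_derive t 1 I (\int[mu]_(x in `]0, L[) dpairing t x).
  move=> tS; have [t2S' t2t] := half tS.
  apply: (is_derive_Rintegral t2t (pairing_up_to_boundary tS)
    (dpairing_up_to_boundary tS)) => s x /andP[ts sS] xL.
  apply: is_derive_pairing => //.
  by rewrite sS (le_lt_trans _ ts)// ltW//; case/andP: t2S'.
have inS t : t \in `[t1, t2] -> 0 < t < S.
  rewrite in_itv/= => /andP[t1t tt2].
  by rewrite (lt_le_trans t1_gt0)// (le_lt_trans tt2).
have inS' t : t \in `]t1, t2[ -> 0 < t < S.
  by move/subset_itv_oo_cc/inS.
apply: (@ler0_derive1_nincr _ I t1 t2) => //.
- by move=> t /inS' /dI[].
- move=> t /inS' tS; have dIt := dI _ tS.
  by rewrite derive1E derive_val; exact: Rintegral_dpairing_le0.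
- by apply: derivable_within_continuous => t /inS /dI[].
Qed.

End solution.

(** * Concrete test functions *)

Section test_functions.
Context {R : realType} {S : R}.

Lemma test_functionD (p pt px pxx r rt rx rxx : R -> R -> R) :
  test_function S p pt px pxx -> test_function S r rt rx rxx ->
  test_function S (fun t x => p t x + r t x) (fun t x => pt t x + rt t x)
    (fun t x => px t x + rx t x) (fun t x => pxx t x + rxx t x).
Proof.
move=> [p1 p2 p3 p4 p5 p6 p7] [r1 r2 r3 r4 r5 r6 r7]; split.
- by move=> t x tS; exact: is_deriveD (p1 t x tS) (r1 t x tS).
- by move=> t x tS; exact: is_deriveD (p2 t x tS) (r2 t x tS).
- by move=> t x tS; exact: is_deriveD (p3 t x tS) (r3 t x tS).
- by move=> z zS; apply: cvgD; [exact: p4|exact: r4].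
- by move=> z zS; apply: cvgD; [exact: p5|exact: r5].
- by move=> z zS; apply: cvgD; [exact: p6|exact: r6].
- by move=> z zS; apply: cvgD; [exact: p7|exact: r7].
Qed.

Lemma test_function_cst (k : R) :
  test_function S (fun _ _ => k) (fun _ _ => 0) (fun _ _ => 0) (fun _ _ => 0).
Proof.
by split=> *; try exact: is_derive_cst; exact: cvg_cst.
Qed.

(** This corrects boundary slopes: the slope changes sign at [l], and the time term contributes
    [- B a] against the [2 e B] produced by diffusion with coefficient [e]. *)
Lemma test_function_quadratic (B l a b : R) :
  test_function S (fun t x => B * ((x - l) ^+ 2 + a * (b - t)))
    (fun _ _ => - (B * a)) (fun _ x => B * (2 * (x - l))) (fun _ _ => B * 2).
Proof.
have c1 (z : R * R) : {for z, continuous (fun z : R * R => z.2 - l)}.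
  by apply: cvgB; [exact: cvg_snd|exact: cvg_cst].
have d1 (x : R) : is_derive x 1 (fun x : R => x - l) 1.
  apply: (is_derive_eq (is_deriveB (is_derive_id x 1) (is_derive_cst l x 1))).
  by rewrite subr0.
split.
- move=> t x _.
  have db : is_derive t 1 (fun t => b - t) (- 1).
    apply: (is_derive_eq (is_deriveB (is_derive_cst b t 1) (is_derive_id t 1))).
    by rewrite sub0r.
  apply: (is_derive_eq (is_deriveZ B (is_deriveD
    (is_derive_cst ((x - l) ^+ 2) t 1) (is_deriveZ a db)))).
  by rewrite /GRing.scale/=; ring.
- move=> t x _.
  apply: (is_derive_eq (is_deriveZ B (is_deriveD (is_deriveM (d1 x) (d1 x))
    (is_derive_cst (a * (b - t)) x 1)))).
  by rewrite /GRing.scale/=; ring.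
- move=> t x _.
  apply: (is_derive_eq (is_deriveZ B (is_deriveZ 2 (d1 x)))).
  by rewrite /GRing.scale/=; ring.
- move=> z _; apply: cvgM; first exact: cvg_cst.
  apply: cvgD; first by apply: cvgM; exact: c1.
  apply: cvgM; first exact: cvg_cst.
  by apply: cvgB; [exact: cvg_cst|exact: cvg_fst].
- by move=> z _; exact: cvg_cst.
- move=> z _; apply: cvgM; first exact: cvg_cst.
  by apply: cvgM; [exact: cvg_cst|exact: c1].
- by move=> z _; exact: cvg_cst.
Qed.

(* The function psi(b - t, x - c), meaningful only for t < b: ln vanishes on
   non-positive reals. *)
Definition heat_gauss (q k b c t x : R) : R :=
  expR (- (q * ln (b - t)) - k * ((x - c) ^+ 2 * (b - t)^-1)).

(** [S <= b] keeps [b - t] positive, so the logarithm and the inverse are smooth; first derivatives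
    are the function times the derivative of its exponent. *)
Lemma test_function_gauss (q k b c : R) : S <= b ->
  test_function S (heat_gauss q k b c)
    (fun t x => heat_gauss q k b c t x *
      (q * (b - t)^-1 - k * ((x - c) ^+ 2 * ((b - t)^-1 * (b - t)^-1))))
    (fun t x => heat_gauss q k b c t x * (- 2 * k * ((x - c) * (b - t)^-1)))
    (fun t x => heat_gauss q k b c t x *
      (4 * k ^+ 2 * ((x - c) ^+ 2 * ((b - t)^-1 * (b - t)^-1))
       - 2 * k * (b - t)^-1)).
Proof.
move=> Sb.
have st t : t < S -> 0 < b - t by move=> tS; rewrite subr_gt0 (lt_le_trans tS).
have cs (z : R * R) : {for z, continuous (fun z : R * R => b - z.1)}.
  by apply: cvgB; [exact: cvg_cst|exact: cvg_fst].
have cx (z : R * R) : {for z, continuous (fun z : R * R => z.2 - c)}.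
  by apply: cvgB; [exact: cvg_snd|exact: cvg_cst].
have cV (z : R * R) : z.1 < S ->
    {for z, continuous (fun z : R * R => (b - z.1)^-1)}.
  by move=> /st zS; apply: cvgV; [rewrite gt_eqF|exact: cs].
have cg (z : R * R) : z.1 < S ->
    {for z, continuous (fun z : R * R => heat_gauss q k b c z.1 z.2)}.
  move=> zS; apply: (continuous_comp (R := (R * R)%type) (f :=
    fun z : R * R => - (q * ln (b - z.1)) -
      k * ((z.2 - c) ^+ 2 * (b - z.1)^-1)) (g := expR)); last first.
    exact: continuous_expR.
  apply: cvgB.
    apply: cvgN; apply: cvgM; first exact: cvg_cst.
    by apply: continuous_comp; [exact: cs|exact: continuous_ln (st _ zS)].
  apply: cvgM; first exact: cvg_cst.
  apply: cvgM; last exact: cV.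
  by apply: cvgM; exact: cx.
have dx (x : R) : is_derive x 1 (fun x : R => x - c) 1.
  apply: (is_derive_eq (is_deriveB (is_derive_id x 1) (is_derive_cst c x 1))).
  by rewrite subr0.
have ds (t : R) : is_derive t 1 (fun t : R => b - t) (- 1).
  apply: (is_derive_eq (is_deriveB (is_derive_cst b t 1) (is_derive_id t 1))).
  by rewrite sub0r.
have gx (t x : R) : t < S -> is_derive x 1 (heat_gauss q k b c t)
    (heat_gauss q k b c t x * (- 2 * k * ((x - c) * (b - t)^-1))).
  move=> tS.
  have d1 := is_deriveD (is_derive_cst (- (q * ln (b - t))) x 1)
    (is_deriveZ (- k) (is_deriveM (is_deriveM (dx x) (dx x))
      (is_derive_cst (b - t)^-1 x 1))).
  have -> : heat_gauss q k b c t = expR \o (fun x : R =>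
      - (q * ln (b - t)) + (- k) * ((x - c) * (x - c) * (b - t)^-1)).
    by apply/funext => y; rewrite /heat_gauss /= mulNr expr2.
  apply: (is_derive_eq (is_derive1_comp (is_derive_expR _) d1)).
  rewrite !fctE /GRing.scale/= mulNr.
  by ring.
split.
- move=> t x tS.
  have sn0 : b - t != 0 by rewrite gt_eqF// st.
  have dl : is_derive t 1 (fun t : R => ln (b - t)) ((b - t)^-1 * - 1).
    exact: (@is_derive1_comp _ (@ln R) (fun t => b - t) _ _ _
      (is_derive1_ln (st _ tS)) (ds t)).
  have dV := @is_deriveV _ (fun t : R => b - t) t (- 1) 1 sn0 (ds t).
  have d1 := is_deriveD (is_deriveZ (- q) dl)
    (is_deriveZ (- k * (x - c) ^+ 2) dV).
  have -> : heat_gauss q k b c ^~ x = expR \o (fun t : R =>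
      (- q) * ln (b - t) + (- k * (x - c) ^+ 2) * (b - t)^-1).
    by apply/funext => y; rewrite /heat_gauss /= !mulNr mulrA.
  apply: (is_derive_eq (is_derive1_comp (is_derive_expR _) d1)).
  rewrite !fctE /GRing.scale/=.
  have -> : heat_gauss q k b c t x =
      expR (- q * ln (b - t) + - k * (x - c) ^+ 2 * (b - t)^-1).
    by rewrite /heat_gauss; congr expR; ring.
  by rewrite -exprVn; ring.
- exact: gx.
- move=> t x tS.
  have d1 : is_derive x 1 (fun x => - 2 * k * ((x - c) * (b - t)^-1))
      (- 2 * k * (b - t)^-1).
    apply: (is_derive_eq (is_deriveZ (- 2 * k)
      (is_deriveM (dx x) (is_derive_cst (b - t)^-1 x 1)))).
    by rewrite /GRing.scale/=; ring.
  apply: (is_derive_eq (is_deriveM (gx t x tS) d1)).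
  by rewrite /GRing.scale/=; ring.
- exact: cg.
- move=> z zS; apply: cvgM; first exact: cg.
  apply: cvgB; (apply: cvgM; first exact: cvg_cst); first exact: cV.
  by apply: cvgM; apply: cvgM; [exact: cx|exact: cx|exact: cV|exact: cV].
- move=> z zS; apply: cvgM; first exact: cg.
  apply: cvgM; first exact: cvg_cst.
  by apply: cvgM; [exact: cx|exact: cV].
- move=> z zS; apply: cvgM; first exact: cg.
  apply: cvgB; (apply: cvgM; first exact: cvg_cst); last exact: cV.
  by apply: cvgM; apply: cvgM; [exact: cx|exact: cx|exact: cV|exact: cV].
Qed.

End test_functions.

(** * Estimates for the Gaussian building block *)

Section gauss_bounds.
Context {R : realType}.
Implicit Types (q k b c t x e L : R).
Notation mu := (@lebesgue_measure R).

Lemma heat_gauss_ge0 q k b c t x : 0 <= heat_gauss q k b c t x.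
Proof. exact: expR_ge0. Qed.

(** With [s = 1 / (b - t)] and [y = x - c], the left side is the Gaussian times
    [(q - 2 e k) s + (4 e k - 1) k (y s)^2], and the two hypotheses make both coefficients
    non-positive. *)
Lemma heat_gauss_supersolution q k b c e t x :
  t < b -> 0 <= k -> q <= 2 * e * k -> 4 * e * k <= 1 ->
  heat_gauss q k b c t x *
    (q * (b - t)^-1 - k * ((x - c) ^+ 2 * ((b - t)^-1 * (b - t)^-1))) +
  e * (heat_gauss q k b c t x *
    (4 * k ^+ 2 * ((x - c) ^+ 2 * ((b - t)^-1 * (b - t)^-1))
     - 2 * k * (b - t)^-1)) <= 0.
Proof.
move=> tb k0 qk ek; have s0 : 0 <= (b - t)^-1 by rewrite invr_ge0 subr_ge0 ltW.
set s := (b - t)^-1; set g := heat_gauss q k b c t x; set y := x - c.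
rewrite [X in X <= _](_ : _ = g * ((q - 2 * e * k) * s
  + (4 * e * k - 1) * (k * (y * s) ^+ 2))); last by ring.
rewrite mulr_ge0_le0 ?heat_gauss_ge0// -oppr_ge0 opprD addr_ge0//.
  by rewrite -mulNr mulr_ge0// opprB subr_ge0.
by rewrite -mulNr mulr_ge0// ?opprB ?subr_ge0// mulr_ge0// sqr_ge0.
Qed.

Lemma heat_gauss_le1 q k b c t x : 0 <= q -> 0 <= k -> 1 <= b - t ->
  heat_gauss q k b c t x <= 1.
Proof.
move=> q0 k0 s1; rewrite /heat_gauss expR_le1 subr_le0 (@le_trans _ _ 0)//.
  by rewrite oppr_le0 mulr_ge0// ln_ge0.
by rewrite mulr_ge0// mulr_ge0 ?sqr_ge0// invr_ge0 (le_trans _ s1).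
Qed.

(** Here [b - t] equals [e^2], so the power factor is exactly [e^(-2q)], while
    [(x - c)^2 / e^2 <= 1] costs at most a factor [exp(-k)]. *)
Lemma heat_gauss_ge q k c t x e : 0 < e -> 0 <= k -> `|x - c| <= e ->
  e `^ (- (2 * q)) * expR (- k) <= heat_gauss q k (t + e ^+ 2) c t x.
Proof.
move=> e0 k0 xe; rewrite /powR gt_eqF// -expRD ler_expR.
have -> : t + e ^+ 2 - t = e ^+ 2 by ring.
rewrite lnXn// lerD//.
  by rewrite le_eqVlt; apply/orP; left; apply/eqP; ring.
rewrite lerN2 ler_piMr// ler_pdivrMr ?exprn_gt0// mul1r.
by rewrite -(real_normK (num_real (x - c))) ler_sqr// nnegrE ltW.
Qed.

(** Away from the centre the Gaussian decay absorbs every power of [1 / (b - t)], so the slope stays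
    bounded as [t] approaches [b]. *)
Lemma heat_gauss_slope_le q k L : 0 <= q <= 1 -> 0 < k -> 0 < L ->
  exists D, 0 < D /\ forall b c t x, t < b -> L <= `|x - c| <= 2 * L ->
    `|heat_gauss q k b c t x * (- 2 * k * ((x - c) * (b - t)^-1))| <= D.
Proof.
(* One summand for each regime: [4 k L] for [b - t >= 1], where [|x - c| <= 2 L] is used, and
   [4 / (k L^3)] for [b - t < 1], where [L <= |x - c|] is used. *)
move=> /andP[q0 q1] k0 L0; exists (4 * k * L + 4 * (k * L ^+ 3)^-1); split.
  by rewrite addr_gt0 ?mulr_gt0// invr_gt0 mulr_gt0// exprn_gt0.
move=> b c t x tb /andP[Ly yL]; set y := x - c in Ly yL *.
have s0 : 0 < b - t by rewrite subr_gt0.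
have y0 : 0 < `|y| by rewrite (lt_le_trans L0).
have -> : `|heat_gauss q k b c t x * (- 2 * k * (y * (b - t)^-1))| =
    2 * k * `|y| * (heat_gauss q k b c t x * (b - t)^-1).
  rewrite !normrM (ger0_norm (heat_gauss_ge0 _ _ _ _ _ _)) (gtr0_norm k0).
  rewrite normrN (gtr0_norm (_ : 0 < 2))//.
  by rewrite (gtr0_norm (_ : 0 < (b - t)^-1)) ?invr_gt0//; ring.
have [s1|s1] := leP 1 (b - t).
  rewrite -[leLHS]addr0 lerD//; last first.
    by rewrite mulr_ge0// invr_ge0 ltW// mulr_gt0// exprn_gt0.
  have gs : heat_gauss q k b c t x * (b - t)^-1 <= 1.
    apply: mulr_ile1; rewrite ?heat_gauss_ge0 ?invf_le1//.
      by rewrite invr_ge0 ltW.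
    by rewrite heat_gauss_le1// ltW.
  apply: (@le_trans _ _ (2 * k * `|y| * 1)).
    by rewrite ler_wpM2l// !mulr_ge0// ltW.
  by rewrite mulr1; nra.
rewrite -[leLHS]add0r lerD//; first by rewrite !mulr_ge0// ltW.
set s := b - t in s0 s1 *; set w := k * (y ^+ 2 * s^-1).
have w0 : 0 < w by rewrite mulr_gt0// divr_gt0// exprn_even_gt0//= -normr_gt0.
(* The power factor is at most [1 / s] because [q <= 1] and [s < 1], and [exp(-w) <= 2 / w^2]
   follows from [exp(w) >= 1 + w^2 / 2]. As [1 / w^2] is proportional to [s^2], all powers of [s]
   cancel in the slope. *)
have g_le : heat_gauss q k b c t x <= s^-1 * (2 / w ^+ 2).
  rewrite /heat_gauss -/s -/y -/w expRD; apply: ler_pM; rewrite ?expR_ge0//.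
    rewrite -[leRHS]lnK ?posrE ?invr_gt0// ler_expR lnV ?posrE// lerN2.
    by rewrite ler_niMl// ln_le0// ltW.
  rewrite expRN -invf_div lef_pV2 ?posrE ?expR_gt0 ?divr_gt0 ?exprn_gt0//.
  by apply: le_trans (expR_ge1Dxn 1 (ltW w0)); rewrite lerDr.
have y2 : `|y| ^+ 2 = y ^+ 2 by rewrite real_normK ?num_real.
apply: (@le_trans _ _ (2 * k * `|y| * (s^-1 * (2 / w ^+ 2) * s^-1))).
  apply: ler_wpM2l; first by rewrite !mulr_ge0// ltW.
  by apply: ler_wpM2r => //; rewrite invr_ge0 ltW.
have -> : 2 * k * `|y| * (s^-1 * (2 / w ^+ 2) * s^-1) = 4 * (k * `|y| ^+ 3)^-1.
  rewrite /w -y2; field.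
  by rewrite !gt_eqF.
rewrite ler_pM2l// lef_pV2 ?posrE ?mulr_gt0 ?exprn_gt0// ler_pM2l//.
by apply: lerXn2r; rewrite ?nnegrE ?normr_ge0// ltW.
Qed.

(** The square is a multiple of the normal density of variance [s / (4 k)], where [s = b - t]. Its
    total mass is [s^(1/2 - 2q)] times a constant, bounded as [s] tends to 0 because [4 q <= 1]. *)
Lemma heat_gauss_sqr_integral_le q k L M : 0 <= q -> 4 * q <= 1 -> 0 < k ->
  1 <= M -> exists G, 0 < G /\ forall b c t, t < b -> b - t <= M ->
    \int[mu]_(x in `]0, L[) (heat_gauss q k b c t x ^+ 2) <= G.
Proof.
move=> q0 q1 k0 M1; set A := pi / (2 * k).
exists (expR (2^-1 * ln M) * Num.sqrt A); split.
  by rewrite mulr_gt0 ?expR_gt0// sqrtr_gt0 divr_gt0 ?pi_gt0// mulr_gt0.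
move=> b c t tb sM; set s := b - t in sM *.
have s0 : 0 < s by rewrite subr_gt0.
pose sg := Num.sqrt (s / (4 * k)).
have sg0 : sg != 0 by rewrite gt_eqF// sqrtr_gt0 divr_gt0// mulr_gt0.
have sgE : sg ^+ 2 = s / (4 * k).
  by rewrite sqr_sqrtr// ltW// divr_gt0// mulr_gt0.
pose W := expR (- (2 * q * ln s)) * (normal_peak sg)^-1.
have W0 : 0 <= W by rewrite mulr_ge0 ?expR_ge0// invr_ge0 normal_peak_ge0.
have gE x : heat_gauss q k b c t x ^+ 2 = W * normal_pdf c sg x.
  rewrite normal_pdfE// /W -mulrA mulKf ?gt_eqF ?normal_peak_gt0//.
  rewrite /heat_gauss /normal_fun sgE -expRM_natl -expRD -/s; congr expR.
  by field; rewrite !gt_eqF.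
have WG : W <= expR (2^-1 * ln M) * Num.sqrt A.
  rewrite /W /normal_peak invrK sgE.
  have -> : s / (4 * k) * pi *+ 2 = s * A.
    by rewrite /A; field; rewrite gt_eqF.
  have sE : Num.sqrt s = expR (2^-1 * ln s).
    rewrite -[s in LHS]lnK ?posrE// -[ln s in LHS](@mulVKf _ 2)//.
    by rewrite expRM_natl sqrtr_sqr ger0_norm ?expR_ge0// mulrC.
  rewrite (sqrtrM _ (ltW s0)) sE mulrA -expRD.
  apply: ler_wpM2r; first exact: sqrtr_ge0.
  rewrite ler_expR.
  have lsM : ln s <= ln M by rewrite ler_ln ?posrE// (lt_le_trans s0).
  have lM0 : 0 <= ln M by rewrite ln_ge0.
  have -> : - (2 * q * ln s) + 2^-1 * ln s = (2^-1 - 2 * q) * ln s by ring.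
  (* For [s <= 1] the product is non-positive, as [1/2 - 2q >= 0]; for [s > 1] the exponent is at
     most [1/2], and [s <= M] concludes. *)
  have [ls0|ls0] := leP (ln s) 0.
    rewrite (@le_trans _ _ 0)//; last by rewrite mulr_ge0.
    by rewrite mulr_ge0_le0// subr_ge0; lra.
  apply: (@le_trans _ _ (2^-1 * ln s)); last exact: ler_wpM2l.
  by apply: ler_wpM2r; [exact: ltW|lra].
apply: le_trans WG.
under eq_Rintegral do rewrite gE.
have ipdf : mu.-integrable `]0, L[ (EFin \o normal_pdf c sg).
  by apply: integrableS (integrable_normal_pdf c sg).
rewrite RintegralZl// ler_piMr//.
rewrite /Rintegral -[leRHS]/(fine 1%:E) fine_le//.
- exact: integrable_fin_num.
- rewrite -(integral_normal_pdf c sg); apply: ge0_subset_integral => //.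
    by apply/measurable_EFinP; exact: measurable_normal_pdf.
  by move=> x _; rewrite lee_fin normal_pdf_ge0.
Qed.
End gauss_bounds.

(** * Square integrals and their behaviour near the initial time *)

Section L2.
Context {R : realType}.
Notation mu := (@lebesgue_measure R).
Implicit Types (D : set R) (g h : R -> R).

Lemma in_Lp_measurable D p g : measurable (D : set (measurableTypeR R)) ->
  in_Lp D p g -> measurable_fun (D : set (measurableTypeR R)) g.
Proof.
by move=> mD /sub_Lfun_mfun; rewrite inE/= => /(measurable_restrictT _ mD).
Qed.

Lemma Lp_norm1E D g : Lp_norm D 1 g = (\int[mu]_(x in D) `|g x|%:E)%E.
Proof.
rewrite /Lp_norm Lnorm1 [RHS]integral_mkcond; apply: eq_integral => x _ /=.
by rewrite !patchE; case: ifP => //=; rewrite normr0.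
Qed.

Lemma Lp_norm2_sqr D g :
  (Lp_norm D 2%:E g `^ 2 = \int[mu]_(x in D) (g x ^+ 2)%:E)%E.
Proof.
rewrite /Lp_norm poweR_Lnorm ?pnatr_eq0// [RHS]integral_mkcond.
apply: eq_integral => x _ /=; rewrite powR_mulrn//.
rewrite real_normK ?num_real// !patchE.
by case: ifP => //= _; rewrite expr0n.
Qed.

(** Finiteness is assumed because [fine] sends an infinite norm to 0. *)
Lemma sqr_integralE D g : (\int[mu]_(x in D) (g x ^+ 2)%:E < +oo)%E ->
  (\int[mu]_(x in D) (g x ^+ 2)%:E = (fine (Lp_norm D 2%:E g) ^+ 2)%:E)%E.
Proof.
rewrite -Lp_norm2_sqr => gfin.
have {}gfin : (Lp_norm D 2%:E g < +oo)%E.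
  by apply: lty_poweRy gfin; rewrite pnatr_eq0.
rewrite -[X in (X `^ 2)%E]fineK; last by rewrite ge0_fin_numE// Lnorm_ge0.
by rewrite poweR_EFin powR_mulrn// fine_ge0// Lnorm_ge0.
Qed.

Lemma Lp_norm2_ae D g h : measurable (D : set (measurableTypeR R)) ->
  measurable_fun (D : set (measurableTypeR R)) g ->
  measurable_fun (D : set (measurableTypeR R)) h ->
  {ae mu, forall x, D x -> g x = h x} ->
  (\int[mu]_(x in D) (g x ^+ 2)%:E = \int[mu]_(x in D) (h x ^+ 2)%:E)%E.
Proof.
move=> mD mg mh gh; apply: ae_eq_integral => //.
- by apply/measurable_EFinP; exact: measurable_funX.
- by apply/measurable_EFinP; exact: measurable_funX.
- apply: (@filterS _ _ (ae_filter_ringOfSetsType _)) gh => x gh Dx.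
  by rewrite gh.
Qed.

(** For small [s] the squared distance from [v s] to [v 0] is at most 1. Then
    [a^2 <= 2 (a - b)^2 + 2 b^2] is integrated; its defect is the square [(a - 2 b)^2]. *)
Lemma sqr_integral_near_initial (L T : R) (v : R -> R -> R) : 0 < L -> 0 < T ->
  continuous_in_Lp L T 2 v ->
  \forall s \near 0^'+, (\int[mu]_(x in `]0%R, L[) (v s x ^+ 2)%:E <=
    2%:E + 2%:E * \int[mu]_(x in `]0%R, L[) (v 0 x ^+ 2)%:E)%E.
Proof.
move=> L0 T0 [vLp vcont].
have T00 : 0 <= (0:R) < T by rewrite lexx.
have /fine_cvgP[vfin vlim] := vcont 0 T00.
have nT : \forall s \near 0^'+, `[0, T[%classic s.
  near=> s; rewrite /= in_itv/=; apply/andP; split; near: s.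
    exact: nbhs_right_ge.
  exact: nbhs_right_lt.
have win (P : set R) : (\forall s \near within `[0, T[ (nbhs (0 : R)), P s) ->
    \forall s \near 0^'+, P s.
  rewrite near_withinE => nP.
  have nP' : \forall s \near 0^'+, `[0, T[%classic s -> P s.
    exact: (cvg_within _ nP).
  by apply: filterS2 nT nP' => s sT; apply.
have small : \forall s \near 0^'+,
    fine (Lp_norm `]0, L[ 2%:E (v s \- v 0)) < 1.
  by apply: win; move/cvgr_lt : vlim; apply.
have {vfin}fin := win _ vfin.
near=> s.
have sT : 0 <= s < T by have : `[0, T[%classic s by near: s.
have mv0 := in_Lp_measurable (measurable_itv _) (vLp 0 T00).
have mvs := in_Lp_measurable (measurable_itv _) (vLp s sT).
have diff1 : (\int[mu]_(x in `]0%R, L[) ((v s x - v 0 x) ^+ 2)%:E <= 1)%E.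
  have s1 : fine (Lp_norm `]0, L[ 2%:E (v s \- v 0)) < 1 by near: s.
  have sfin : Lp_norm `]0, L[ 2%:E (v s \- v 0) \is a fin_num by near: s.
  rewrite -(Lp_norm2_sqr `]0, L[ (v s \- v 0)) -(fineK sfin) poweR_EFin.
  rewrite powR_mulrn ?fine_ge0 ?Lnorm_ge0// lee_fin.
  by rewrite expr_le1 ?fine_ge0 ?Lnorm_ge0// ltW.
have mdiff : measurable_fun (`]0, L[%classic : set (measurableTypeR R))
    (fun x => ((v s x - v 0 x) ^+ 2)%:E).
  by apply/measurable_EFinP/measurable_funX; exact: measurable_funB.
have msq (w : R -> R) :
    measurable_fun (`]0, L[%classic : set (measurableTypeR R)) w ->
    measurable_fun (`]0, L[%classic : set (measurableTypeR R))
    (fun x => (w x ^+ 2)%:E).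
  by move=> mw; apply/measurable_EFinP/measurable_funX.
apply: (@le_trans _ _ (\int[mu]_(x in `]0%R, L[)
    (2%:E * ((v s x - v 0 x) ^+ 2)%:E + 2%:E * (v 0 x ^+ 2)%:E))%E).
  apply: ge0_le_integral => //.
  - by move=> x _; rewrite lee_fin sqr_ge0.
  - exact: msq.
  - apply: emeasurable_funD; apply: emeasurable_funM => //; exact: msq.
  - move=> x _; rewrite -!EFinM -EFinD lee_fin -subr_ge0.
    rewrite (_ : _ - _ = (v s x - 2 * v 0 x) ^+ 2) ?sqr_ge0//; ring.
rewrite ge0_integralD//=; last 4 first.
- by move=> x _; rewrite -EFinM lee_fin mulr_ge0// sqr_ge0.
- by apply: emeasurable_funM => //; exact: msq.
- by move=> x _; rewrite -EFinM lee_fin mulr_ge0// sqr_ge0.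
- by apply: emeasurable_funM => //; exact: msq.
have sq_ge0 (w : R -> R) x : (0 <= (w x ^+ 2)%:E)%E by rewrite lee_fin sqr_ge0.
rewrite ge0_integralZl// ge0_integralZl//; last exact: msq.
by rewrite leeD2r// -[leRHS]mule1 lee_pmul2l.
Unshelve. all: end_near. Qed.
End L2.

(** * Square integrals of the solution just after time 0 *)

Section bounds.
Context {R : realType} {m : nat} {L S : R} {d : 'I_m -> R}.
Context {f : 'I_m -> R -> R -> 'rV[R]_m -> R} {init : 'I_m -> R -> R}.
Context {u : 'I_m -> R -> R -> R}.
Context (L_gt0 : 0 < L) (S_gt0 : 0 < S) (d_gt0 : forall i, 0 < d i).
Context (f0 : mass_conserving L f).
Context (u_sol : classical_solution L d f init S u).
Context (u_ge0 : nonnegative L S u).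
Notation mu := (@lebesgue_measure R).

Lemma integrable_continuous_oo (v : R -> R) : continuous v ->
  mu.-integrable `]0, L[ (EFin \o v).
Proof.
move=> cv; have sub : `]0, L[ `<=` `[0, L]%classic by exact: subset_itv_oo_cc.
apply: (@integrableS _ _ R mu _ _ _ _ _ sub) => //.
apply: continuous_compact_integrable; first exact: segment_compact.
exact: continuous_subspaceT.
Qed.

Lemma Rintegral_cst_oo (c : R) : \int[mu]_(x in `]0, L[) c = c * L.
Proof.
rewrite Rintegral_cst//= lebesgue_measure_itv/= lte_fin L_gt0.
by rewrite -EFinB subr0.
Qed.

Lemma integrable_sum_oo (v : 'I_m -> R -> R) :
  (forall i, {within `[0, L], continuous (v i)}) ->
  mu.-integrable `]0, L[ (EFin \o (fun x => \sum_i v i x)).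
Proof.
move=> cv; have sub : `]0, L[ `<=` `[0, L]%classic by exact: subset_itv_oo_cc.
apply: (@integrableS _ _ R mu _ _ _ _ _ sub) => //.
apply: continuous_compact_integrable; first exact: segment_compact.
by move=> x; apply: cvg_big => [|i _]; [exact: add_continuous|exact: cv].
Qed.

(** The preceding estimate is applied to each component; [u i 0] equals [init i] almost everywhere,
    so the data enter through their [L^2] norms. *)
Lemma sol_sqr_initial : initial_datum L init ->
  \forall t \near 0^'+, \int[mu]_(x in `]0, L[) (\sum_i u i t x ^+ 2) <=
    \sum_i (2 + 2 * fine (Lp_norm `]0%R, L[ 2%:E (init i)) ^+ 2).
Proof.
move=> u0; have lt12 : 1 < 2 :> R by rewrite ltr1n.
have init2 i : (\int[mu]_(x in `]0%R, L[) (u i 0%R x ^+ 2)%:E =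
    (fine (Lp_norm `]0%R, L[ 2%:E (init i)) ^+ 2)%:E)%E.
  have [uLp _] := cs_Lp u_sol i lt12.
  have u0Lp : in_Lp `]0, L[ 2%:E (u i 0) by apply: uLp; rewrite lexx.
  have uE : (\int[mu]_(x in `]0%R, L[) (u i 0%R x ^+ 2)%:E =
      \int[mu]_(x in `]0%R, L[) (init i x ^+ 2)%:E)%E.
    apply: Lp_norm2_ae => //.
    - exact: in_Lp_measurable u0Lp.
    - exact: in_Lp_measurable (u0 i).1.
    - apply: (@filterS _ _ (ae_filter_ringOfSetsType _)) (cs_initial u_sol i).
      by move=> x ux; rewrite /= in_itv/=; exact: ux.
  rewrite uE; apply: sqr_integralE; rewrite -uE -Lp_norm2_sqr.
  apply: poweR_lty; move: u0Lp => /sub_Lfun_finLfun.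
  by rewrite inE.
have near_i i : \forall t \near 0^'+,
    (\int[mu]_(x in `]0%R, L[) (u i t x ^+ 2)%:E <=
    (2 + 2 * fine (Lp_norm `]0%R, L[ 2%:E (init i)) ^+ 2)%:E)%E.
  have := sqr_integral_near_initial L_gt0 S_gt0 (cs_Lp u_sol i lt12).
  by apply: filterS => t; rewrite init2 -EFinM -EFinD.
have near_all := filter_forall _ near_i.
near=> t.
have tS : 0 < t < S.
  by apply/andP; split; near: t; [exact: nbhs_right_gt|exact: nbhs_right_lt].
have ut i : (\int[mu]_(x in `]0%R, L[) (u i t x ^+ 2)%:E <=
    (2 + 2 * fine (Lp_norm `]0%R, L[ 2%:E (init i)) ^+ 2)%:E)%E.
  by move: i; near: t; exact: near_all.
have cu2 i : {within `[0, L], continuous (fun x => u i t x ^+ 2)}.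
  by move=> x; apply: cvgM; exact: (sol_slice_continuous u_sol tS).
have iu2 i : mu.-integrable `]0, L[ (EFin \o (fun x => u i t x ^+ 2)).
  have sub : `]0, L[ `<=` `[0, L]%classic by exact: subset_itv_oo_cc.
  apply: (@integrableS _ _ R mu _ _ _ _ _ sub) => //.
  by apply: continuous_compact_integrable => //; exact: segment_compact.
have sum_le : (\int[mu]_(x in `]0%R, L[) (\sum_i u i t x ^+ 2)%:E <=
    (\sum_i (2 + 2 * fine (Lp_norm `]0%R, L[ 2%:E (init i)) ^+ 2))%:E)%E.
  under eq_integral do rewrite -sumEFin.
  rewrite ge0_integral_sum//; last 2 first.
  - by move=> i; have /integrableP[] := iu2 i.
  - by move=> i x _; rewrite lee_fin sqr_ge0.
  by rewrite -sumEFin; apply: lee_sum => i _; exact: ut.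
rewrite /Rintegral -lee_fin fineK//; apply: integrable_fin_num => //.
exact: integrable_sum_oo.
Unshelve. all: end_near. Qed.
End bounds.

(** * The reflected barrier *)

Section barrier.
Context {R : realType}.
Notation mu := (@lebesgue_measure R).

(* The images centred at - x0 and 2 L - x0 cancel the slope of the main term at
   0 and at L respectively. At each end the slope of the remaining image is at
   most D, because its centre is at distance at least L; the quadratic term with
   B = D / L compensates it. *)
Lemma reflected_barrier (L lam Lam q k : R) :
  0 < L -> 0 < k -> 0 <= lam -> 0 <= q -> 4 * q <= 1 ->
  q <= 2 * lam * k -> 4 * Lam * k <= 1 ->
  exists G P : R, [/\ 0 < G, 0 < P & forall T eps x0 S : R,
    0 < eps < L -> 0 < x0 < L -> S <= T + eps ^+ 2 ->
  exists phi phit phix phixx : R -> R -> R,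
  [/\ test_function S phi phit phix phixx,
      forall e t x, lam <= e <= Lam -> t < S -> phit t x + e * phixx t x <= 0,
      forall t, t < S -> phix t 0 <= 0 <= phix t L
    & forall t x, t < S -> 0 <= phi t x] /\
  [/\ forall x, `|x - x0| <= eps ->
        eps `^ (- (2 * q)) * expR (- k) <= phi T x,
      forall t, T - 1 <= t < S ->
        \int[mu]_(x in `]0, L[) (phi t x ^+ 2) <= G
    & forall x, T - 1 < S -> 0 < x < L -> phi (T - 1) x <= P]].
Proof.
move=> L0 k0 lam0 q0 q14 qk kLam.
have q01 : 0 <= q <= 1 by rewrite q0; lra.
have [D [D0 slope]] := heat_gauss_slope_le q01 k0 L0.
(* [1 + L^2] bounds [b - t = T + eps^2 - t] when [t >= T - 1] and [eps < L]. *)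
have M1 : 1 <= 1 + L ^+ 2 by rewrite lerDl sqr_ge0.
have [G [G0 sqrG]] := heat_gauss_sqr_integral_le L q0 q14 k0 M1.
(* [a] lets the time decay of the quadratic dominate its diffusion for every [e <= Lam]; [B] gives
   it the slopes [-D] at 0 and [D] at [L]; [Q] bounds it from time [T - 1] on. *)
pose a := 2 * `|Lam|; have a0 : 0 <= a by rewrite mulr_ge0.
pose B := D / L; have B0 : 0 < B by rewrite divr_gt0.
have BL : B * L = D by rewrite divfK// gt_eqF.
pose Q := B * (L ^+ 2 + a * (1 + L ^+ 2)).
have Q0 : 0 <= Q.
  rewrite mulr_ge0 ?(ltW B0)// addr_ge0 ?sqr_ge0// mulr_ge0//.
  exact: le_trans M1.
(* The square of a sum of four terms is at most four times the sum of their squares; at time [T - 1]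
   each of the three Gaussians is at most 1. *)
exists (4 * (3 * G + Q ^+ 2 * L)), (3 + Q); split.
- by rewrite mulr_gt0// ltr_pwDl ?mulr_gt0// mulr_ge0 ?sqr_ge0// ltW.
- by rewrite ltr_pwDl.
move=> T eps x0 S /andP[eps0 epsL] /andP[x00 x0L] Sb.
pose b := T + eps ^+ 2.
have eps2 : eps ^+ 2 <= L ^+ 2 by rewrite ler_sqr ?nnegrE ltW.
have T1 := test_functionD (test_functionD (test_functionD
  (test_function_gauss q k x0 Sb) (test_function_gauss q k (- x0) Sb))
  (test_function_gauss q k (2 * L - x0) Sb))
  (@test_function_quadratic R S B (L / 2) a b).
do 4 eexists; split; first split; first exact: T1.
- move=> e t x /andP[lame eLam] tS /=.
  have tb : t < b by rewrite (lt_le_trans tS).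
  have qe : q <= 2 * e * k.
    by rewrite (le_trans qk)// ler_pM2r// ler_pM2l.
  have ek : 4 * e * k <= 1.
    by rewrite (le_trans _ kLam)// ler_pM2r// ler_pM2l.
  have s c := heat_gauss_supersolution c x tb (ltW k0) qe ek.
  have sq : - (B * a) + e * (B * 2) <= 0.
    have eL : e <= `|Lam| by rewrite (le_trans eLam)// ler_norm.
    rewrite /a; nra.
  have := lerD (lerD (lerD (s x0) (s (- x0))) (s (2 * L - x0))) sq.
  rewrite !addr0; apply: le_trans; rewrite le_eqVlt; apply/orP; left; apply/eqP.
  by rewrite -/b; ring.
- move=> t tS /=; have tb : t < b by rewrite (lt_le_trans tS).
  have gE c c' x x' : (x - c) ^+ 2 = (x' - c') ^+ 2 ->
      heat_gauss q k b c t x = heat_gauss q k b c' t x'.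
    by rewrite /heat_gauss => ->.
  have bt : b - t != 0 by rewrite subr_eq0 gt_eqF.
  apply/andP; split.
    have yL : L <= `|0 - (2 * L - x0)| <= 2 * L.
      by rewrite sub0r normrN ger0_norm; [apply/andP; split|]; lra.
    have := le_trans (ler_norm _) (slope b (2 * L - x0) t 0 tb yL).
    rewrite -/b (gE (- x0) x0 0 0); last by ring.
    rewrite -subr_le0 -BL; apply: le_trans; rewrite le_eqVlt.
    by apply/orP; left; apply/eqP; field; rewrite bt.
  have yL : L <= `|L - - x0| <= 2 * L.
    by rewrite ger0_norm; [apply/andP; split|]; lra.
  have := slope b (- x0) t L tb yL; rewrite -normrN.
  move=> /(le_trans (ler_norm _)).
  rewrite -/b (gE (2 * L - x0) x0 L L); last by ring.
  rewrite -subr_ge0 -BL => /le_trans; apply; rewrite le_eqVlt.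
  by apply/orP; left; apply/eqP; field; rewrite bt.
- move=> t x tS /=; rewrite !addr_ge0 ?heat_gauss_ge0//.
  rewrite mulr_ge0 ?(ltW B0)// addr_ge0 ?sqr_ge0// mulr_ge0//.
  by rewrite subr_ge0 (le_trans (ltW tS)).
have quad_le t x : T - 1 <= t -> t < S -> 0 < x < L ->
    0 <= B * ((x - L / 2) ^+ 2 + a * (b - t)) <= Q.
  move=> Tt tS /andP[x_gt0 xL]; have bt0 : 0 <= b - t.
    by rewrite subr_ge0 (le_trans (ltW tS)).
  apply/andP; split.
    by rewrite mulr_ge0 ?(ltW B0)// addr_ge0 ?sqr_ge0// mulr_ge0.
  rewrite /Q ler_pM2l// lerD//; first by nra.
  by rewrite ler_wpM2l// /b; lra.
split.
- move=> x xx0 /=; rewrite -addrA -addrA.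
  apply: (le_trans (heat_gauss_ge q T eps0 (ltW k0) xx0)).
  rewrite lerDl !addr_ge0 ?heat_gauss_ge0// mulr_ge0 ?(ltW B0)//.
  by rewrite addr_ge0 ?sqr_ge0// mulr_ge0// /b addrC addKr sqr_ge0.
- move=> t /andP[Tt tS] /=; have tb : t < b by rewrite (lt_le_trans tS).
  have sM : b - t <= 1 + L ^+ 2 by rewrite /b; lra.
  have cg c : continuous (heat_gauss q k b c t).
    move=> x; apply/differentiable_continuous/derivable1_diffP.
    by have [] := test_x (test_function_gauss q k c Sb) x tS.
  have cg2 c : continuous (fun x => heat_gauss q k b c t x ^+ 2).
    by move=> x; apply: cvgM; exact: cg.
  have cphi : continuous (fun x => heat_gauss q k b x0 t x +
      heat_gauss q k b (- x0) t x + heat_gauss q k b (2 * L - x0) t x +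
      B * ((x - L / 2) ^+ 2 + a * (b - t))).
    by move=> x; apply/differentiable_continuous/derivable1_diffP;
      have [] := test_x T1 x tS.
  have ig c := @integrable_continuous_oo R L _ (cg2 c).
  have iQ := @integrable_continuous_oo R L (fun=> Q ^+ 2)
    (@cst_continuous _ _ _).
  pose F x := 4 * (heat_gauss q k b x0 t x ^+ 2 +
    heat_gauss q k b (- x0) t x ^+ 2 +
    heat_gauss q k b (2 * L - x0) t x ^+ 2 + Q ^+ 2).
  have cF : continuous F.
    move=> x; apply: cvgM; first exact: cvg_cst.
    by do 3 (apply: cvgD; last (exact: cg2 || exact: cvg_cst)); exact: cg2.
  apply: (@le_trans _ _ (\int[mu]_(x in `]0, L[) F x)).
    apply: le_Rintegral => //.
    - apply: integrable_continuous_oo => x.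
      by apply: cvgM; exact: cphi.
    - exact: integrable_continuous_oo.
    move=> x; rewrite /= in_itv/= => xL.
    have /andP[Qx0 QxQ] := quad_le t x Tt tS xL.
    have QQ : (B * ((x - L / 2) ^+ 2 + a * (b - t))) ^+ 2 <= Q ^+ 2.
      by rewrite ler_sqr.
    rewrite /F; move: QQ; set g1 := heat_gauss _ _ _ _ _ _.
    set g2 := heat_gauss _ _ _ _ _ _; set g3 := heat_gauss _ _ _ _ _ _.
    set g4 := B * _ => QQ.
    (* The defect of this inequality is, up to the bound on [g4], the sum of the six squared
       differences. *)
    have := sqr_ge0 (g1 - g2); have := sqr_ge0 (g1 - g3).
    have := sqr_ge0 (g1 - g4); have := sqr_ge0 (g2 - g3).
    have := sqr_ge0 (g2 - g4); have := sqr_ge0 (g3 - g4); nra.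
  pose g2 c x := heat_gauss q k b c t x ^+ 2.
  have c2 : continuous (fun x => g2 x0 x + g2 (- x0) x).
    by move=> x; apply: cvgD; exact: cg2.
  have c3 : continuous (fun x => g2 x0 x + g2 (- x0) x + g2 (2 * L - x0) x).
    by move=> x; apply: cvgD; [exact: c2|exact: cg2].
  have c4 : continuous
      (fun x => g2 x0 x + g2 (- x0) x + g2 (2 * L - x0) x + Q ^+ 2).
    by move=> x; apply: cvgD; [exact: c3|exact: cvg_cst].
  have iL := @integrable_continuous_oo R L.
  rewrite RintegralZl//; last exact: iL c4.
  rewrite (RintegralD _ (iL _ c3) iQ)// (RintegralD _ (iL _ c2) (ig _))//.
  rewrite (RintegralD _ (ig _) (ig _))// Rintegral_cst_oo//.
  rewrite ler_pM2l// lerD2r.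
  have := sqrG b x0 t tb sM; have := sqrG b (- x0) t tb sM.
  by have := sqrG b (2 * L - x0) t tb sM; lra.
- move=> x T1S xL /=.
  have /andP[_ QxQ] := quad_le (T - 1) x (lexx _) T1S xL.
  have s1 : 1 <= b - (T - 1) by rewrite /b; have := sqr_ge0 eps; lra.
  have g1 c := heat_gauss_le1 c x q0 (ltW k0) s1.
  have := g1 x0; have := g1 (- x0); have := g1 (2 * L - x0).
  by rewrite -/b; lra.
Qed.
End barrier.

(** * From the pairing to the mass of a small interval *)

Section main_bound.
Context {R : realType} {m : nat} {L S : R} {d : 'I_m -> R}.
Context {f : 'I_m -> R -> R -> 'rV[R]_m -> R} {init : 'I_m -> R -> R}.
Context {u : 'I_m -> R -> R -> R}.
Context (L_gt0 : 0 < L) (S_gt0 : 0 < S) (d_gt0 : forall i, 0 < d i).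
Context (f0 : mass_conserving L f).
Context (u_sol : classical_solution L d f init S u).
Context (u_ge0 : nonnegative L S u).
Context (u_init : initial_datum L init).
Notation mu := (@lebesgue_measure R).

Let E := \sum_i (2 + 2 * fine (Lp_norm `]0%R, L[ 2%:E (init i)) ^+ 2).

Let measurable_oo : measurable (`]0, L[%classic : set (measurableTypeR R)).
Proof. exact: measurable_itv. Qed.

Lemma integrable_pairing t (w : R -> R) : 0 < t < S -> continuous w ->
  mu.-integrable `]0, L[ (EFin \o (fun x => \sum_i u i t x * w x)).
Proof.
move=> tS cw; apply: (integrable_sum_oo (v := fun i x => u i t x * w x)) => i x.
apply: cvgM; first exact: (sol_slice_continuous u_sol tS).
by apply: continuous_subspaceT => y; exact: cw.
Qed.

Lemma integrable_sum_sqr t : 0 < t < S ->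
  mu.-integrable `]0, L[ (EFin \o (fun x => \sum_i u i t x ^+ 2)).
Proof.
move=> tS; apply: (integrable_sum_oo (v := fun i x => u i t x ^+ 2)) => i x.
by apply: cvgM; exact: (sol_slice_continuous u_sol tS).
Qed.

(** Young's inequality is used in each component; [w] is common to all of them, hence the factor
    [m]. *)
Lemma pairing_young t (w : R -> R) : 0 < t < S -> continuous w ->
  \int[mu]_(x in `]0, L[) (\sum_i u i t x * w x) <=
  2^-1 * (\int[mu]_(x in `]0, L[) (\sum_i u i t x ^+ 2) +
          m%:R * \int[mu]_(x in `]0, L[) (w x ^+ 2)).
Proof.
move=> tS cw.
have cw2 : continuous (fun x => w x ^+ 2) by move=> x; apply: cvgM; exact: cw.
have iw := integrable_continuous_oo (L := L) cw2.
have imw : mu.-integrable `]0, L[ (EFin \o (fun x => m%:R * w x ^+ 2)).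
  exact: (integrableZl measurable_oo m%:R iw).
have iu := integrable_sum_sqr tS.
have is_ : mu.-integrable `]0, L[
    (EFin \o (fun x => \sum_i u i t x ^+ 2 + m%:R * w x ^+ 2)).
  exact: (integrableD measurable_oo iu imw).
rewrite -(RintegralZl _ measurable_oo iw).
rewrite -(RintegralD measurable_oo iu imw).
rewrite -(RintegralZl _ measurable_oo is_).
apply: le_Rintegral => //.
- exact: integrable_pairing.
- exact: (integrableZl measurable_oo 2^-1 is_).
move=> x _.
have -> : m%:R * w x ^+ 2 = \sum_(i < m) w x ^+ 2.
  by rewrite sumr_const card_ord mulr_natl.
rewrite -big_split mulr_sumr/=; apply: ler_sum => i _.
by have := sqr_ge0 (u i t x - w x); nra.
Qed.

Lemma exists_small_time eta : 0 < eta -> exists2 t, 0 < t < eta &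
  \int[mu]_(x in `]0, L[) (\sum_i u i t x ^+ 2) <= E.
Proof.
move=> eta0; have nE := sol_sqr_initial L_gt0 S_gt0 u_sol u_init.
have [t []] : exists t, 0 < t < eta /\
    \int[mu]_(x in `]0, L[) (\sum_i u i t x ^+ 2) <= E.
  near (0 : R)^'+ => t; exists t; split; last by near: t.
  by apply/andP; split; near: t; [exact: nbhs_right_gt|exact: nbhs_right_lt].
by exists t.
Unshelve. all: end_near. Qed.

(** One constant covers both ranges of [T]: Young's inequality gives [(E + m G) / 2] when [T <= 1],
    and [P (E + m L) / 2] when [T > 1]. *)
Lemma barrier_pairing_le T G P (phi phit phix phixx : R -> R -> R) :
  0 < T < S -> 0 < P -> 0 < G ->
  test_function S phi phit phix phixx ->
  (forall i (t x : R), 0 < t < S -> 0 < x < L ->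
    phit t x + d i * phixx t x <= 0) ->
  (forall t, t < S -> phix t 0 <= 0 <= phix t L) ->
  (forall t, T - 1 <= t < S ->
     \int[mu]_(x in `]0, L[) (phi t x ^+ 2) <= G) ->
  (forall x, T - 1 < S -> 0 < x < L -> phi (T - 1) x <= P) ->
  \int[mu]_(x in `]0, L[) (\sum_i u i T x * phi T x) <=
  (P + 1) * (E + m%:R * (L + G)).
Proof.
move=> /andP[T0 TS] P0 G0 tphi sphi bphi phiG phiP.
have dec := pairing_nonincreasing L_gt0 d_gt0 f0 u_sol u_ge0 tphi sphi
  (fun t tS => proj1 (andP (bphi t (proj2 (andP tS)))))
  (fun t tS => proj2 (andP (bphi t (proj2 (andP tS))))).
have E0 : 0 <= E.
  by apply: sumr_ge0 => i _; rewrite addr_ge0// mulr_ge0// sqr_ge0.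
have m0 : 0 <= m%:R :> R by [].
have mL0 : 0 <= m%:R * L by rewrite mulr_ge0// ltW.
have mG0 : 0 <= m%:R * G by rewrite mulr_ge0// ltW.
have cphi t : t < S -> continuous (phi t).
  move=> tS x; apply/differentiable_continuous/derivable1_diffP.
  by have [] := test_x tphi x tS.
have [T1|T1] := leP T 1.
  have [t1 /andP[t10 t1T] t1E] := exists_small_time T0.
  have t1S := lt_trans t1T TS.
  apply: (le_trans (dec _ _ t10 (ltW t1T) TS)).
  have tS : 0 < t1 < S by rewrite t10.
  apply: (le_trans (pairing_young tS (cphi _ t1S))).
  (* As [T <= 1], every positive time is later than [T - 1], so the square bound on [phi] applies at
     [t1]. *)
  have w1 : T - 1 <= t1 < S by rewrite t1S andbT; lra.
  have := ler_wpM2l m0 (phiG _ w1).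
  have := mulr_ge0 (ltW P0) E0; have := mulr_ge0 (ltW P0) mL0.
  have := mulr_ge0 (ltW P0) mG0; lra.
have T10 : 0 < T - 1 by rewrite subr_gt0.
have T1T : T - 1 < T by rewrite ltrBlDr ltrDl.
have T1S := lt_trans T1T TS.
have TT : 0 < T - 1 < S by rewrite T10.
apply: (le_trans (dec _ _ T10 (ltW T1T) TS)).
have c1 : continuous (fun _ : R => 1 : R) by exact: cst_continuous.
apply: (@le_trans _ _ (P * \int[mu]_(x in `]0, L[) (\sum_i u i (T - 1) x * 1))).
  rewrite -(RintegralZl _ measurable_oo (integrable_pairing TT c1)).
  apply: le_Rintegral => //.
  - by apply: integrable_pairing => //; exact: cphi.
  - exact: (integrableZl measurable_oo P (integrable_pairing TT c1)).
  move=> x; rewrite /= in_itv/= => xL; rewrite mulr_sumr; apply: ler_sum => i _.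
  rewrite mulr1 mulrC; apply: ler_wpM2r; first exact: u_ge0.
  exact: phiP.
(* The constant 1 is itself an admissible test function, so the total mass at [T - 1] is at most the
   mass at an earlier time near 0, where the [L^2] bound holds. *)
have [t0 /andP[t00 t0T] t0E] := exists_small_time T10.
have t0S := lt_trans t0T T1S.
have mle : \int[mu]_(x in `]0, L[) (\sum_i u i (T - 1) x * 1) <=
    \int[mu]_(x in `]0, L[) (\sum_i u i t0 x * 1).
  apply: (pairing_nonincreasing L_gt0 d_gt0 f0 u_sol u_ge0
    (test_function_cst 1) _ _ _ t00 (ltW t0T) T1S) => //.
  by move=> i t x _ _; rewrite mulr0 addr0.
have tS : 0 < t0 < S by rewrite t00.
have yg := pairing_young tS c1.
have I1 : \int[mu]_(x in `]0, L[) (1 ^+ 2) = L :> R.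
  by under eq_Rintegral do rewrite expr1n; rewrite Rintegral_cst_oo// mul1r.
rewrite I1 in yg.
have PE := mulr_ge0 (ltW P0) E0; have PL := mulr_ge0 (ltW P0) mL0.
have PG := mulr_ge0 (ltW P0) mG0.
apply: (@le_trans _ _ (P * (2^-1 * (E + m%:R * L)))).
  by rewrite ler_pM2l//; lra.
lra.
Qed.
(** All terms are non-negative, so dropping the other components and the complement of [A] only
    decreases the pairing, and on [A] the weight is at least [c]. *)
Lemma local_mass_le i T c (A : set R) (w : R -> R) :
  0 < T < S -> 0 <= c -> measurable (A : set (measurableTypeR R)) ->
  A `<=` `]0, L[ -> continuous w -> (forall x, 0 < x < L -> 0 <= w x) ->
  (forall x, A x -> c <= w x) ->
  (c%:E * Lp_norm A 1 (u i T) <=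
   (\int[mu]_(x in `]0%R, L[) (\sum_j u j T x * w x))%:E)%E.
Proof.
move=> TS c0 mA AL cw w0 cA.
have AI x : A x -> 0 < x < L by move=> /AL; rewrite /= in_itv.
have iuw := integrable_pairing TS cw.
have /integrableP[muw _] := iuw.
have mui : measurable_fun (A : set (measurableTypeR R)) (u i T).
  apply: (measurable_funS (E := `]0, L[%classic)) => //.
  have sub : `]0, L[ `<=` `[0, L]%classic by exact: subset_itv_oo_cc.
  apply: (measurable_funS (E := `[0, L]%classic)) => //.
  apply: subspace_continuous_measurable_fun => //.
  exact: (sol_slice_continuous u_sol TS).
have sum_ge0 x : 0 < x < L -> 0 <= \sum_j u j T x * w x.
  move=> xL; apply: sumr_ge0 => j _.
  by rewrite mulr_ge0 ?w0// u_ge0.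
rewrite Lp_norm1E -ge0_integralZl//; last first.
  by apply/measurable_EFinP; exact: measurableT_comp.
rewrite /Rintegral fineK; last exact: integrable_fin_num.
apply: (@le_trans _ _ (\int[mu]_(x in A) (\sum_j u j T x * w x)%:E)%E).
  apply: ge0_le_integral => //.
  - by move=> x _; rewrite -EFinM lee_fin mulr_ge0.
  - by apply/measurable_EFinP/measurable_funM => //; exact: measurableT_comp.
  - exact: measurable_funS muw.
  - move=> x Ax; rewrite -EFinM lee_fin ger0_norm ?u_ge0 ?AI//.
    rewrite (bigD1 i)//= -[leLHS]addr0 lerD//.
      by rewrite mulrC ler_wpM2l ?u_ge0 ?cA ?AI.
    by apply: sumr_ge0 => j _; rewrite mulr_ge0 ?w0 ?u_ge0 ?AI.
by apply: ge0_subset_integral => // x; rewrite /= in_itv => /sum_ge0.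
Qed.
End main_bound.

(** The horizon [S] must lie beyond [T] and below [Tmax], yet not beyond the singular time
    [b = T + eps^2] of the barrier. *)
Lemma exists_horizon (R : realType) (T b : R) (Tmax : \bar R) :
  T < b -> (T%:E < Tmax)%E -> exists S, [/\ T < S, S <= b & (S%:E < Tmax)%E].
Proof.
move=> Tb; case: Tmax => [t| |]// Tt; last by exists b; rewrite Tb lexx ltry.
rewrite lte_fin in Tt; exists (Num.min b ((T + t) / 2)).
have [h1 h2] := midf_lt Tt.
by split; rewrite ?lt_min ?Tb ?h1 ?ge_min ?lexx// lte_fin gt_min h2 orbT.
Qed.

(** * Choice of constants and conclusion *)

Theorem proposition3p1 (R : realType) (L : R) (m : nat) (d : 'I_m -> R)
  (L_gt0 : 0 < L) (m_ge1 : (1 <= m)%N) (d_gt0 : forall i, 0 < d i) :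
  exists (delta : R) (K : ('I_m -> R) -> R),
    0 < delta /\ (forall N, 0 < K N) /\
    forall f : 'I_m -> R -> R -> 'rV[R]_m -> R,
      locally_lipschitz_uniformly L f -> quasi_positive L f ->
      mass_conserving L f -> intermediate_sums L f ->
    forall (u0 : 'I_m -> R -> R) (Tmax : \bar R) (u : 'I_m -> R -> R -> R),
      initial_datum L u0 -> maximal_solution L d f u0 Tmax u ->
    forall T : R, 0 < T -> (T%:E < Tmax)%E ->
      (ereal_sup [set morrey_norm L delta (u i T) | i in [set: 'I_m]] <=
       (K (fun i => fine (Lp_norm `]0%R, L[ 2%:E (u0 i))))%:E)%E.
Proof.
(* Substitutes for the minimum and the maximum of the [d_i]: [1 / lam] exceeds every [1 / d_i],
   [Lam] exceeds every [d_i], and the added 1 gives [lam <= 1 <= Lam]. *)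
pose lam := (\sum_i (d i)^-1 + 1)^-1; pose Lam := \sum_i d i + 1.
have sum_inv_ge0 : 0 <= \sum_i (d i)^-1.
  by apply: sumr_ge0 => i _; rewrite invr_ge0 ltW.
have sum_ge0 : 0 <= \sum_i d i by apply: sumr_ge0 => i _; rewrite ltW.
have lam0 : 0 < lam by rewrite invr_gt0 ltr_wpDl.
have lam1 : lam <= 1 by rewrite invf_le1 ?ltr_wpDl// lerDr.
have Lam1 : 1 <= Lam by rewrite lerDr.
have d_itv i : lam <= d i <= Lam.
  apply/andP; split.
    rewrite -[leRHS]invrK lef_pV2 ?posrE ?invr_gt0 ?ltr_wpDl//.
    rewrite (bigD1 i)//= -addrA lerDl addr_ge0//.
    by apply: sumr_ge0 => j _; rewrite invr_ge0 ltW.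
  rewrite /Lam (bigD1 i)//= -addrA lerDl addr_ge0//.
  by apply: sumr_ge0 => j _; rewrite ltW.
(* [k] is the Gaussian rate [1 / (4 Lam)]; [q = lam / (4 Lam)] is below both [lam / (2 Lam)] and
   [1 / 4]. *)
pose k := (4 * Lam)^-1; pose q := lam * k.
have Lam0 : 0 < Lam by rewrite (lt_le_trans _ Lam1).
have k0 : 0 < k by rewrite invr_gt0 mulr_gt0.
have q0 : 0 < q by rewrite mulr_gt0.
have kLam : 4 * Lam * k = 1 by rewrite divff// gt_eqF// mulr_gt0.
have kLam1 : 4 * Lam * k <= 1 by rewrite kLam.
have q14 : 4 * q <= 1.
  by rewrite /q mulrA -[leRHS]kLam ler_pM2r//; lra.
have qk : q <= 2 * lam * k.
  by rewrite /q ler_pM2r//; lra.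
have [G [P [G0 P0 barrier]]] := reflected_barrier L_gt0 k0 (ltW lam0) (ltW q0)
  q14 qk kLam1.
(* The factor [expR k] undoes the loss [expR (- k)] in the lower bound of the barrier, and the final
   [+ 1] makes [K] positive. *)
exists (2 * q), (fun N => expR k *
  ((P + 1) * (\sum_i (2 + 2 * N i ^+ 2) + m%:R * (L + G)) + 1)).
split; first by rewrite mulr_gt0.
split.
  move=> N; rewrite mulr_gt0 ?expR_gt0// ltr_wpDl// mulr_ge0//.
    by rewrite addr_ge0// ltW.
  apply: addr_ge0; last by rewrite mulr_ge0// ltW// addr_gt0.
  by apply: sumr_ge0 => i _; rewrite addr_ge0// mulr_ge0// sqr_ge0.
move=> f _ _ f0 _ u0 Tmax u u0_init [_ u_sol _] T T0 TTmax.
apply: ge_ereal_sup => _ [i _ <-]; apply: ge_ereal_sup => y [eps [x0]].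
move=> [epsL x0L ->]; have /andP[eps0 _] := epsL.
have [S [TS Sb STmax]] : exists S,
    [/\ T < S, S <= T + eps ^+ 2 & (S%:E < Tmax)%E].
  by apply: exists_horizon => //; rewrite ltrDl exprn_gt0.
have S0 : 0 < S by rewrite (lt_trans T0).
have [sol sol_ge0] := u_sol S S0 STmax.
(* The barrier depends on [T], [eps] and [x0], but [G] and [P] were fixed before them, which makes
   the final bound uniform. *)
have [phi [phit [phix [phixx]]]] := barrier T eps x0 S epsL x0L Sb.
move=> [[tphi sphi bphi phi0] [phi_low phi_sqr phi_P]].
have T0S : 0 < T < S by rewrite T0.
have cphi : continuous (phi T).
  move=> x; apply/differentiable_continuous/derivable1_diffP.
  by have [] := test_x tphi x TS.
have main := barrier_pairing_le L_gt0 S0 d_gt0 f0 sol sol_ge0 u0_init T0S P0 G0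
  tphi (fun j t x tS _ => sphi (d j) t x (d_itv j) (proj2 (andP tS)))
  bphi phi_sqr phi_P.
set A := `[(x0 - eps)%R, (x0 + eps)%R] `&` `]0%R, L[.
have mA : measurable (A : set (measurableTypeR R)).
  by apply: measurableI; exact: measurable_itv.
have cE : 0 <= eps `^ (- (2 * q)) * expR (- k).
  by rewrite mulr_ge0 ?powR_ge0 ?expR_ge0.
have low x : A x -> eps `^ (- (2 * q)) * expR (- k) <= phi T x.
  move=> [/=]; rewrite in_itv/= => /andP[xl xr] _; apply: phi_low.
  by rewrite ler_distlC; apply/andP; split; lra.
have loc := local_mass_le sol sol_ge0 i T0S cE mA (@subIsetr _ _ _) cphi
  (fun x _ => phi0 T x TS) low.
have -> : eps `^ (- (2 * q)) =
    expR k * (eps `^ (- (2 * q)) * expR (- k)).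
  by rewrite [RHS]mulrCA -expRD subrr expR0 mulr1.
rewrite EFinM -muleA [leRHS]EFinM; apply: lee_pmul => //.
  by rewrite mule_ge0// Lnorm_ge0.
by apply: (le_trans loc); rewrite lee_fin (le_trans main)// lerDl.
Qed.
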